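(* Let $n\ge 3$ be an integer and let $a,c>0$ be real numbers. A compact hyperbolic antiprism $\mathcal{A}_n(a,c)$ in $\mathbb{H}^3$ with the symmetry group $S_{2n}$ and edge lengths $a,c$ exists if and only if $$1+\cosh a-2\cosh c+2\,(1-\cosh c)\cos\frac{\pi}{n}<0.$$
   Context: $\mathbb{H}^3$ is hyperbolic $3$-space of constant curvature $-1$. An antiprism $\mathcal{A}_n$ is a (non-degenerate, i.e. $3$-dimensional) convex polyhedron with $2n$ vertices having two equal regular $n$-gons as its top and bottom faces and $2n$ equal triangles as its lateral faces. It has the symmetry group $S_{2n}$, the cyclic group generated by a mirror-rotational symmetry of order $2n$: the composition of the rotation by the angle $\pi/n$ about the axis passing through the centres of the top and bottom faces with the reflection in a plane perpendicular to this axis (which passes through the midpoints of the lateral edges). This group acts transitively on the vertices: the vertices are $V_1,\dots,V_{2n}$ (indices modulo $2n$), where the generator maps $V_i\mapsto V_{i+1}$; the odd-indexed vertices form the top $n$-gon, the even-indexed vertices form the bottom $n$-gon, and the lateral faces are the triangles $V_iV_{i+1}V_{i+2}$. ''Compact'' means that all vertices are (finite) points of $\mathbb{H}^3$. There are two types of edges: $a$ denotes the hyperbolic length of the edges of the top and bottom $n$-gonal faces (the edges $V_iV_{i+2}$), and $c$ denotes the hyperbolic length of the lateral edges (the edges $V_iV_{i+1}$). $\mathcal{A}_n(a,c)$ denotes the antiprism $\mathcal{A}_n$ given by its edge lengths $a,c$. *)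

(* Defs.v *)
From HB Require Import structures.
From mathcomp Require Import all_boot all_order all_algebra.
From mathcomp Require Import all_classical all_reals all_analysis.

Set Implicit Arguments.
Unset Strict Implicit.
Unset Printing Implicit Defensive.
Import Order.TTheory GRing.Theory Num.Theory.

Local Open Scope classical_set_scope.
Local Open Scope ring_scope.

Definition cosh (R : realType) (x : R) : R := (expR x + expR (- x)) / 2.

(* The inverse of cosh on [1, +oo[ with values in [0, +oo[. *)
Definition arcosh (R : realType) (y : R) : R := ln (y + Num.sqrt (y ^+ 2 - 1)).

(** Hyperbolic 3-space: the upper sheet of the hyperboloid in R^{3,1},
    coordinate 0 being the timelike one. *)

Definition mink (R : realType) (x y : 'rV[R]_4) : R :=
  \sum_(i < 3) x 0 (lift ord0 i) * y 0 (lift ord0 i) - x 0 ord0 * y 0 ord0.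

Definition H3 (R : realType) : Type :=
  {x : 'rV[R]_4 | (mink x x == -1) && (0 < x 0 ord0)}.

Definition hvec (R : realType) (x : H3 R) : 'rV[R]_4 := sval x.
Coercion hvec : H3 >-> matrix.

Definition hdist (R : realType) (x y : H3 R) : R := arcosh (- mink x y).

Definition hseg (R : realType) (x y : H3 R) : set (H3 R) :=
  [set z | hdist x z + hdist z y = hdist x y].

Definition hcollinear (R : realType) (x y z : H3 R) : Prop :=
  [\/ hseg x y z, hseg y z x | hseg z x y].

Definition hconvex (R : realType) (P : set (H3 R)) : Prop :=
  forall x y, P x -> P y -> hseg x y `<=` P.

Definition hhull (R : realType) (S : set (H3 R)) : set (H3 R) :=
  smallest (@hconvex R) S.

(* A (totally geodesic) plane of H3 when the normal v is spacelike, that is,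
   when 0 < mink v v. *)
Definition hplane (R : realType) (v : 'rV[R]_4) : set (H3 R) :=
  [set x | mink x v = 0].

(* The projection of x to the tangent space y^perp of H3 at y; for x != y
   it is a positive multiple of the initial velocity of the geodesic from y
   to x. *)
Definition htangent (R : realType) (y x : H3 R) : 'rV[R]_4 :=
  (x : 'rV[R]_4) + mink x y *: (y : 'rV[R]_4).

(* The angle at y of the triangle x y z. *)
Definition hangle (R : realType) (x y z : H3 R) : R :=
  let u := htangent y x in
  let v := htangent y z in
  acos (mink u v / (Num.sqrt (mink u u) * Num.sqrt (mink v v))).

Definition hisometry (R : realType) (f : H3 R -> H3 R) : Prop :=
  bijective f /\ forall x y, hdist (f x) (f y) = hdist x y.

Definition hcongruent (R : realType) (A B : set (H3 R)) : Prop :=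
  exists2 f, hisometry f & f @` A = B.

(** Rotations, reflections and mirror rotations. *)

Definition spacelike_orthonormal (R : realType) (e1 e2 e3 : 'rV[R]_4) : Prop :=
  [/\ mink e1 e1 = 1, mink e2 e2 = 1 & mink e3 e3 = 1] /\
  [/\ mink e1 e2 = 0, mink e1 e3 = 0 & mink e2 e3 = 0].

(* For e1, e2 orthonormal and spacelike, the rotation by the angle phi about
   the geodesic cut out on H3 by {e1, e2}^perp: the identity on {e1, e2}^perp
   and the planar rotation by phi in the basis (e1, e2) of the complement. *)
Definition hrot (R : realType) (e1 e2 : 'rV[R]_4) (phi : R) (x : 'rV[R]_4) :
    'rV[R]_4 :=
  let x1 := mink x e1 in
  let x2 := mink x e2 in
  x + (cos phi * x1 - sin phi * x2 - x1) *: e1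
    + (sin phi * x1 + cos phi * x2 - x2) *: e2.

(* For mink e e = 1, the reflection in the plane hplane e. *)
Definition hrefl (R : realType) (e x : 'rV[R]_4) : 'rV[R]_4 :=
  x - (2 * mink x e) *: e.

(* The rotation by phi about the axis {e1, e2}^perp followed by the reflection
   in hplane e3; that plane is perpendicular to the axis because e3 is a
   tangent direction of the axis. *)
Definition hmirror_rotation (R : realType) (phi : R) (g : H3 R -> H3 R) :
    Prop :=
  exists e1 e2 e3 : 'rV[R]_4, spacelike_orthonormal e1 e2 e3 /\
    forall x, hvec (g x) = hrefl e3 (hrot e1 e2 phi x).

(** Convex polyhedra. *)

(* The second clause is non-degeneracy: P is 3-dimensional. *)
Definition hpolyhedron (R : realType) (P : set (H3 R)) : Prop :=
  (exists2 S : set (H3 R), finite_set S & P = hhull S) /\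
  forall v, 0 < mink v v -> ~ P `<=` hplane v.

Definition hvertex (R : realType) (P : set (H3 R)) : set (H3 R) :=
  [set x | P x /\ forall y z, P y -> P z -> hseg y z x -> x = y \/ x = z].

(* The intersection of P with a supporting plane. *)
Definition hface (R : realType) (P F : set (H3 R)) : Prop :=
  exists v : 'rV[R]_4,
    [/\ 0 < mink v v, (forall x, P x -> mink x v <= 0)
      & F = P `&` hplane v].

(* A 2-dimensional face. *)
Definition hfacet (R : realType) (P F : set (H3 R)) : Prop :=
  hface P F /\ exists x y z, [/\ F x, F y, F z & ~ hcollinear x y z].

(* w enumerates A without repetition, with indices modulo m. *)
Definition cyclic_enum (R : realType) (m : nat) (w : nat -> H3 R)
    (A : set (H3 R)) : Prop :=
  (forall i, w (i + m)%N = w i) /\ set_bij `I_m A w.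

(* F is a convex n-gon with consecutive vertices w 0, w 1, ..., w n.-1 (so that
   its sides are [w i, w i.+1]), equilateral and equiangular. *)
Definition regular_polygon (R : realType) (n : nat) (w : nat -> H3 R)
    (F : set (H3 R)) : Prop :=
  [/\ cyclic_enum n w (hvertex F),
      F = hhull (range w),
      (forall i, hface F (hseg (w i) (w i.+1))),
      (forall i j, hdist (w i) (w i.+1) = hdist (w j) (w j.+1))
    & (forall i j, hangle (w i) (w i.+1) (w i.+2) =
                   hangle (w j) (w j.+1) (w j.+2))].

(** Antiprisms; the vertices V i are indexed modulo 2n. *)

Definition top_face (R : realType) (V : nat -> H3 R) : set (H3 R) :=
  hhull (V @` [set i | odd i]).

Definition bottom_face (R : realType) (V : nat -> H3 R) : set (H3 R) :=
  hhull (V @` [set i | ~~ odd i]).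

Definition lateral_face (R : realType) (V : nat -> H3 R) (i : nat) :
    set (H3 R) :=
  hhull [set V i; V i.+1; V i.+2].

Definition antiprism (R : realType) (n : nat) (P : set (H3 R))
    (V : nat -> H3 R) : Prop :=
  [/\ hpolyhedron P,
      cyclic_enum n.*2 V (hvertex P),
      (forall F, hfacet P F <->
         [\/ F = top_face V, F = bottom_face V
           | exists i, F = lateral_face V i]),
      [/\ regular_polygon n (fun j => V j.*2.+1) (top_face V),
          regular_polygon n (fun j => V j.*2) (bottom_face V)
        & hcongruent (top_face V) (bottom_face V)]
    & forall i j, hcongruent (lateral_face V i) (lateral_face V j)].

(* P is invariant under the cyclic group S_{2n} generated by a mirror rotation
   g by the angle pi / n, and g shifts the labelling of the vertices. *)
Definition S2n_symmetric (R : realType) (n : nat) (P : set (H3 R))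
    (V : nat -> H3 R) : Prop :=
  exists g, [/\ hmirror_rotation (pi / n%:R) g, g @` P = P
              & forall i, g (V i) = V i.+1].

Definition edge_lengths (R : realType) (V : nat -> H3 R) (a c : R) : Prop :=
  forall i, hdist (V i) (V i.+2) = a /\ hdist (V i) (V i.+1) = c.

(* Main.v *)
Require Import Defs.
From mathcomp Require Import all_boot all_order all_algebra.
From mathcomp Require Import all_classical all_reals all_analysis.
From mathcomp Require Import ring lra zify.
Set Implicit Arguments.
Unset Strict Implicit.
Unset Printing Implicit Defensive.
Import Order.TTheory GRing.Theory Num.Theory.
Local Open Scope classical_set_scope.
Local Open Scope ring_scope.

(** Everything takes place in the hyperboloid model.  In coordinates adapted to
    the mirror rotation the vertices are
    [V i = (T, r cos (i pi/n), r sin (i pi/n), (-1)^i h)], and the Minkowski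
    products of consecutive vertices give
    [cosh a = 1 + 2 r^2 (1 - cos^2 (pi/n))] and
    [cosh c = 1 + r^2 (1 - cos (pi/n)) + 2 h^2].  Eliminating [r], the quantity
    of the theorem equals [- 4 (1 + cos (pi/n)) h^2] ([condition_height]).  It
    is therefore never positive, and it is negative exactly when [h <> 0].

    Necessity ([antiprism_condition]).  If [h = 0], the vertices lie in the
    plane of symmetry, which is then the only plane that can carry a lateral
    face.  The antiprism lies on one side of it and is preserved by a map that
    exchanges the sides, so it is contained in the plane, against
    non-degeneracy.

    Sufficiency ([antiprism_hull], [S2n_symmetric_hull], [edge_lengths_vert]).
    If the quantity is negative, the two equations have a solution with [r > 0]
    and [h <> 0], and the hull of the points [V i] is the required antiprism.
    What has to be checked is its face structure.  Segments of [H3] are cones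
    ([hsegP]), so that convexity is governed by the linear forms [mink _ v]: the
    intersection of a hull with a supporting plane is the hull of the generators
    on that plane ([hhull_support]).  On the vertices such a form takes values
    [p l + (-1)^l B - C], where [p] is the restriction to the regular [2n]-gon of
    a linear form of the Euclidean plane.  A facet contains three vertices, hence
    two of the same parity, and equality of [p] at these two says that
    [p l = A cos ((l - m) pi/n)] for some integer [m] and some [A >= 0]
    ([normal_of_equal_values]).  If [A = 0] the facet is a base; otherwise it is
    the lateral face centred at [V m] ([support_classification]).  Conversely,
    explicit choices of [A], [B], [C] show that bases and lateral faces are
    facets, that the sides of a base are its edges, and that the [V i] are
    extreme. *)

(** * The hyperbolic cosine and its inverse *)

Section Arcosh.
Variable R : realType.
Implicit Types p q x : R.

Lemma sqr_cosh_sub1 x : cosh x ^+ 2 - 1 = ((expR x - expR (- x)) / 2) ^+ 2.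
Proof.
have h : expR x * expR (- x) = 1 by rewrite -expRD subrr expR0.
by rewrite /cosh -[X in _ - X = _]h; field.
Qed.

Lemma cosh_gt1 x : 0 < x -> 1 < cosh x.
Proof.
move=> x0; have h : expR x * expR (- x) = 1 by rewrite -expRD subrr expR0.
have := expR_gt0 (- x); have : 1 < expR x by rewrite expR_gt1.
rewrite /cosh; move: h; set u := expR x; set v := expR (- x); nra.
Qed.

Lemma coshK x : 0 <= x -> arcosh (cosh x) = x.
Proof.
move=> x0; rewrite /arcosh sqr_cosh_sub1 sqrtr_sqr ger0_norm.
  by rewrite /cosh (_ : _ + _ = expR x) ?expRK//; field.
by rewrite divr_ge0// subr_ge0 ler_expR; lra.
Qed.

Lemma sqr_sqrt_sub1 p : 1 <= p -> Num.sqrt (p ^+ 2 - 1) ^+ 2 = p ^+ 2 - 1.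
Proof. by move=> p1; rewrite sqr_sqrtr//; nra. Qed.

Lemma arcosh_arg_gt0 p : 1 <= p -> p + Num.sqrt (p ^+ 2 - 1) \is Num.pos.
Proof. by move=> p1; rewrite posrE; have := sqrtr_ge0 (p ^+ 2 - 1); lra. Qed.

Lemma cosh_arcosh p : 1 <= p -> cosh (arcosh p) = p.
Proof.
move=> p1; rewrite /cosh expRN /arcosh lnK ?arcosh_arg_gt0//.
have := arcosh_arg_gt0 p1; rewrite posrE => q0.
have := sqr_sqrt_sub1 p1; move: q0; set s := Num.sqrt _ => q0 hs.
suff -> : (p + s)^-1 = p - s by field.
apply: (mulfI (lt0r_neq0 q0)); rewrite divff ?lt0r_neq0//.
by rewrite mulrC -subr_sqr hs; ring.
Qed.

Lemma arcosh_inj p q : 1 <= p -> 1 <= q -> arcosh p = arcosh q -> p = q.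
Proof. by move=> p1 q1 e; rewrite -(cosh_arcosh p1) e cosh_arcosh. Qed.

(** The addition theorem for the hyperbolic cosine, read on the arguments of
    [arcosh]: it turns equality in the triangle inequality into an algebraic
    relation between values of the Minkowski form. *)
Lemma arcoshD p q : 1 <= p -> 1 <= q ->
  arcosh p + arcosh q =
  arcosh (p * q + Num.sqrt (p ^+ 2 - 1) * Num.sqrt (q ^+ 2 - 1)).
Proof.
move=> p1 q1; rewrite /arcosh -lnM ?arcosh_arg_gt0//; congr ln.
have := sqr_sqrt_sub1 p1; have := sqr_sqrt_sub1 q1.
have := sqrtr_ge0 (p ^+ 2 - 1); have := sqrtr_ge0 (q ^+ 2 - 1).
set s := Num.sqrt (p ^+ 2 - 1); set t := Num.sqrt (q ^+ 2 - 1).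
move=> t0 s0 ht hs.
rewrite [in RHS](_ : _ - 1 = (p * t + q * s) ^+ 2); first last.
  by rewrite !sqrrD !exprMn ht hs; ring.
by rewrite sqrtr_sqr ger0_norm; [ring | nra].
Qed.

End Arcosh.

(** * The Minkowski form *)

Section Minkowski.
Variable R : realType.
Implicit Types (u v w : 'rV[R]_4) (x y z : H3 R) (k : R).

Definition vec4 (t a b c : R) : 'rV[R]_4 := \row_i [:: t; a; b; c]`_i.

Lemma vec4_eta u : exists t a b c, u = vec4 t a b c.
Proof.
exists (u 0 0), (u 0 1), (u 0 2%R), (u 0 3%R); apply/rowP => i; rewrite mxE.
case: i => [[|[|[|[|//]]]] p] /=; congr (u _ _); exact: val_inj.
Qed.

Lemma mink_vec4 t a b c t' a' b' c' :
  mink (vec4 t a b c) (vec4 t' a' b' c') = a * a' + b * b' + c * c' - t * t'.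
Proof. by rewrite /mink !big_ord_recl big_ord0 !mxE /=; ring. Qed.

Lemma minkC u v : mink u v = mink v u.
Proof. by rewrite /mink mulrC; congr (_ - _); apply: eq_bigr => i _; rewrite mulrC. Qed.

Lemma minkDl u v w : mink (u + v) w = mink u w + mink v w.
Proof. by rewrite /mink !big_ord_recl !big_ord0 !mxE; ring. Qed.

Lemma minkZl k u v : mink (k *: u) v = k * mink u v.
Proof. by rewrite /mink !big_ord_recl !big_ord0 !mxE; ring. Qed.

Lemma minkDr u v w : mink w (u + v) = mink w u + mink w v.
Proof. by rewrite minkC minkDl !(minkC w). Qed.

Lemma minkZr k u v : mink v (k *: u) = k * mink v u.
Proof. by rewrite minkC minkZl minkC. Qed.

Lemma minkNl u v : mink (- u) v = - mink u v.
Proof. by rewrite -scaleN1r minkZl mulN1r. Qed.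

Lemma minkNr u v : mink v (- u) = - mink v u.
Proof. by rewrite minkC minkNl minkC. Qed.

Lemma mink0l u : mink 0 u = 0.
Proof. by rewrite -(scale0r 0) minkZl mul0r. Qed.

Lemma mink0r u : mink u 0 = 0.
Proof. by rewrite minkC mink0l. Qed.

Definition minkE := (minkDl, minkZl, minkDr, minkZr, minkNl, minkNr).

(** The form has a single negative direction: by Lagrange's identity (the
    Cauchy-Schwarz inequality on the spatial coordinates) it is positive
    definite on the orthogonal complement of a timelike vector. *)
Lemma mink_orth_gt0 w u : mink w w < 0 -> mink u w = 0 -> u != 0 ->
  0 < mink u u.
Proof.
have [t [a [b [c ->]]]] := vec4_eta w.
have [t' [a' [b' [c' ->]]]] := vec4_eta u.
rewrite !mink_vec4 => hw /eqP; rewrite subr_eq0 => /eqP hu un0.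
set A := a' * a' + b' * b' + c' * c'; set B := a * a + b * b + c * c.
have hB : 0 <= B by rewrite /B; nra.
have tB : B < t * t by rewrite /B; lra.
have hC : (t' * t) ^+ 2 <= A * B.
  have -> : A * B = (t' * t) ^+ 2 + (a' * b - b' * a) ^+ 2
      + (b' * c - c' * b) ^+ 2 + (c' * a - a' * c) ^+ 2.
    by rewrite -hu /A /B; ring.
  by rewrite -!addrA lerDl !addr_ge0// sqr_ge0.
have hA : 0 <= A by rewrite /A; nra.
have {hA}: 0 < A.
  rewrite lt_def hA andbT; apply: contraNneq un0 => A0.
  have a0 : a' = 0 by move: A0; rewrite /A; nra.
  have b0 : b' = 0 by move: A0; rewrite /A; nra.
  have c0 : c' = 0 by move: A0; rewrite /A; nra.
  have t0 : t' = 0.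
    move: hu; rewrite a0 b0 c0 !mul0r !addr0 => /esym/eqP.
    by rewrite mulf_eq0 => /orP[/eqP//|/eqP tz]; move: tB; rewrite tz; lra.
  rewrite a0 b0 c0 t0; apply/eqP/rowP => i; rewrite !mxE.
  by case: i => [[|[|[|[|//]]]]].
move=> A0; rewrite subr_gt0.
have : (t' * t) ^+ 2 < A * (t * t) by apply: (le_lt_trans hC); rewrite ltr_pM2l.
by have t0 : 0 < t * t := le_lt_trans hB tB; rewrite exprMn !expr2 ltr_pM2r.
Qed.

Lemma mink_orth_ge0 w u : mink w w < 0 -> mink u w = 0 -> 0 <= mink u u.
Proof.
move=> hw hu; have [->|u0] := eqVneq u 0; first by rewrite mink0l.
exact: ltW (mink_orth_gt0 hw hu u0).
Qed.

Lemma mink_orth_eq0 w u : mink w w < 0 -> mink u w = 0 -> mink u u = 0 -> u = 0.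
Proof.
move=> hw hu h0; apply/eqP; apply: contraT => /(mink_orth_gt0 hw hu).
by rewrite h0 ltxx.
Qed.

Lemma H3_norm x : mink x x = -1.
Proof. by case: x => v /= /andP[/eqP]. Qed.

Lemma H3_norm_lt0 x : mink x x < 0.
Proof. by rewrite H3_norm; lra. Qed.

(** This certifies the normal of a supporting plane: it is enough to exhibit a
    point of the plane and a point outside of it. *)
Lemma spacelike_of_orth x y v : mink x v = 0 -> mink y v != 0 -> 0 < mink v v.
Proof.
move=> xv yv; apply: (mink_orth_gt0 (H3_norm_lt0 x)); first by rewrite minkC.
by apply: contraNneq yv => ->; rewrite mink0r.
Qed.

Lemma H3_time_gt0 x : 0 < hvec x 0 ord0.
Proof. by case: x => v /= /andP[]. Qed.

Lemma hvec_inj x y : hvec x = hvec y -> x = y.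
Proof. exact: val_inj. Qed.

Definition mkH3 u (h : (mink u u == -1) && (0 < u 0 ord0)) : H3 R :=
  exist _ u h.

Lemma H3_mink_lt0 x y : mink x y < 0.
Proof.
move: (H3_norm x) (H3_norm y) (H3_time_gt0 x) (H3_time_gt0 y).
have [t [a [b [c ->]]]] := vec4_eta x.
have [t' [a' [b' [c' ->]]]] := vec4_eta y.
rewrite !mink_vec4 !mxE /= => hx hy t0 t'0; rewrite subr_lt0 ltNge.
apply/negP => h; have tt : 0 < t * t' by apply: mulr_gt0.
have : (t * t') ^+ 2 <= (a * a' + b * b' + c * c') ^+ 2.
  by rewrite ler_sqr ?nnegrE; lra.
have -> : (t * t') ^+ 2 = (a * a + b * b + c * c + 1) * (a' * a' + b' * b' + c' * c' + 1).
  have -> : a * a + b * b + c * c = t * t - 1 by lra.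
  have -> : a' * a' + b' * b' + c' * c' = t' * t' - 1 by lra.
  by ring.
have := sqr_ge0 (a' * b - b' * a); have := sqr_ge0 (b' * c - c' * b).
have := sqr_ge0 (c' * a - a' * c); nra.
Qed.

(** The form is nonnegative on [y^perp], hence at the projection
    [x + mink x y *: y] of [x], whose square is [(mink x y)^2 - 1]. *)
Lemma H3_mink_ge1 x y : 1 <= - mink x y.
Proof.
have := @mink_orth_ge0 y (hvec x + mink x y *: hvec y) (H3_norm_lt0 y).
rewrite !minkE !H3_norm (minkC y x) => /(_ ltac:(ring)).
have := H3_mink_lt0 x y; nra.
Qed.

Lemma H3_eq x y : mink x y = -1 -> x = y.
Proof.
move=> h; apply: hvec_inj; apply/eqP; rewrite -subr_eq0; apply/eqP.
have hp : mink (hvec x - hvec y) y = 0 by rewrite !minkE H3_norm h; ring.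
apply: (mink_orth_eq0 (H3_norm_lt0 y) hp).
by rewrite minkDr minkNr hp !minkE (minkC y x) h H3_norm; ring.
Qed.

Lemma cosh_hdist x y : cosh (hdist x y) = - mink x y.
Proof. by rewrite cosh_arcosh// H3_mink_ge1. Qed.

End Minkowski.

(** * Geodesic segments as cones *)

Section Segments.
Variable R : realType.
Implicit Types (u v w : 'rV[R]_4) (x y z p q s : H3 R) (a b c k : R).

(** Equality in the triangle inequality for [x], [z], [y] says, by [arcoshD],
    that the projections [u], [w] of [x], [y] to [z^perp] satisfy equality in
    the Cauchy-Schwarz inequality and point in opposite directions.  Hence
    some nonnegative combination of [u] and [w] vanishes, which puts [z] in
    the cone spanned by [x] and [y]. *)
Lemma hsegP x y z :
  hseg x y z <->
  exists a b, [/\ 0 <= a, 0 <= b & hvec z = a *: hvec x + b *: hvec y].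
Proof.
have p1 := H3_mink_ge1 x z; have q1 := H3_mink_ge1 z y.
have r1 := H3_mink_ge1 x y; rewrite /hseg /= /hdist arcoshD//.
have hs := sqr_sqrt_sub1 p1; have ht := sqr_sqrt_sub1 q1.
have s0 := sqrtr_ge0 ((- mink x z) ^+ 2 - 1).
have t0 := sqrtr_ge0 ((- mink z y) ^+ 2 - 1).
split.
  move=> /arcosh_inj; move: p1 q1 r1 hs ht s0 t0.
  set s := Num.sqrt _; set t := Num.sqrt _.
  set p := - mink x z; set q := - mink z y; set r := - mink x y.
  move=> p1 q1 r1 hs ht s0 t0 /(_ ltac:(nra) r1) e.
  pose T := t *: (hvec x - p *: hvec z) + s *: (hvec y - q *: hvec z).
  have xz : mink x z = - p by rewrite /p opprK.
  have zy : mink z y = - q by rewrite /q opprK.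
  have xy : mink x y = - r by rewrite /r opprK.
  have T0 : T = 0.
    apply: (mink_orth_eq0 (H3_norm_lt0 z)); rewrite /T !minkE !H3_norm.
      by rewrite (minkC y z) zy xz; ring.
    rewrite !(minkC y x) !(minkC y z) !(minkC z x) !xz !zy !xy -e.
    rewrite [LHS](_ : _ = t ^+ 2 * (p ^+ 2 - 1) + s ^+ 2 * (q ^+ 2 - 1) - 2 * t ^+ 2 * s ^+ 2); last by ring.
    by rewrite -hs -ht; ring.
  have [k0|k0] := eqVneq (t * p + s * q) 0.
    have s00 : s = 0 by nra.
    have p11 : p = 1 by move: hs; rewrite s00; nra.
    exists 1, 0; split => //; rewrite scale1r scale0r addr0.
    by congr hvec; apply/esym/H3_eq; rewrite xz p11.
  have kp : 0 < t * p + s * q by rewrite lt_def k0; nra.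
  exists (t / (t * p + s * q)), (s / (t * p + s * q)).
  split; rewrite ?divr_ge0// ?(ltW kp)//.
  apply: (scalerI k0); rewrite scalerDr !scalerA !(mulrC _ (_ / _)) !divfK//.
  apply/esym/eqP; rewrite -subr_eq0 -T0 /T; apply/eqP/rowP => i.
  by rewrite !mxE; ring.
case=> a [b] [a0 b0 hz].
have hn := H3_norm z; rewrite hz !minkE !H3_norm (minkC y x) in hn.
set r := - mink x y in r1 *; have xy : mink x y = - r by rewrite /r opprK.
rewrite xy in hn.
have -> : mink x z = - (a + b * r) by rewrite hz !minkE H3_norm xy; ring.
have -> : mink z y = - (a * r + b) by rewrite hz !minkE H3_norm xy; ring.
have w0 := sqrtr_ge0 (r ^+ 2 - 1); have hw := sqr_sqrt_sub1 r1.
have n1 : a ^+ 2 + b ^+ 2 + 2 * a * b * r = 1 by lra.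
rewrite !opprK [(a + _) ^+ 2 - 1](_ : _ = (b * Num.sqrt (r ^+ 2 - 1)) ^+ 2).
  rewrite [(a * r + _) ^+ 2 - 1](_ : _ = (a * Num.sqrt (r ^+ 2 - 1)) ^+ 2).
    rewrite !sqrtr_sqr !ger0_norm ?mulr_ge0//; congr arcosh.
    rewrite mulrACA -expr2 hw -[RHS]mulr1 -[X in _ = _ * X]n1; ring.
  by rewrite exprMn hw; lra.
by rewrite exprMn hw; lra.
Qed.

Lemma hsegl x y : hseg x y x.
Proof. by apply/hsegP; exists 1, 0; rewrite scale1r scale0r addr0; split. Qed.

Lemma hsegr x y : hseg x y y.
Proof. by apply/hsegP; exists 0, 1; rewrite scale1r scale0r add0r; split. Qed.

(** The time coordinate is positive on [H3], which forces [c < 0]. *)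
Lemma hseg_of_dependent x y z a b c : 0 <= a -> 0 <= b ->
  ~ [/\ a = 0, b = 0 & c = 0] ->
  a *: hvec x + b *: hvec y + c *: hvec z = 0 -> hseg x y z.
Proof.
move=> a0 b0 n0 e; have := congr1 (fun u : 'rV_4 => u 0 ord0) e.
rewrite !mxE.
have := H3_time_gt0 x; have := H3_time_gt0 y; have := H3_time_gt0 z.
set x0 := hvec x _ _; set y0 := hvec y _ _; set z0 := hvec z _ _.
move=> zp yp xp et.
have c0 : c < 0.
  rewrite ltNge; apply/negP => cp; apply: n0.
  have e0 (k t : R) : 0 < t -> k * t = 0 -> k = 0.
    by move=> t0 /eqP; rewrite mulf_eq0 (gt_eqF t0) orbF => /eqP.
  have h1 : 0 <= a * x0 by rewrite mulr_ge0// ltW.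
  have h2 : 0 <= b * y0 by rewrite mulr_ge0// ltW.
  have h3 : 0 <= c * z0 by rewrite mulr_ge0// ltW.
  have e1 : a * x0 = 0 by lra.
  have e2 : b * y0 = 0 by lra.
  have e3 : c * z0 = 0 by lra.
  by split; [apply: e0 e1|apply: e0 e2|apply: e0 e3].
apply/hsegP; exists (a / - c), (b / - c).
have c0' : 0 <= - c by rewrite oppr_ge0 ltW.
split; rewrite ?divr_ge0//.
have cn : - c != 0 by rewrite oppr_eq0 lt_eqF.
apply: (scalerI cn); rewrite scalerDr !scalerA !(mulrC (- c)) !divfK//.
by apply/esym/eqP; rewrite -subr_eq0 -e scaleNr opprK.
Qed.

(** Two of the three coefficients have the same sign. *)
Lemma hcollinear_of_dependent x y z a b c :
  ~ [/\ a = 0, b = 0 & c = 0] ->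
  a *: hvec x + b *: hvec y + c *: hvec z = 0 -> hcollinear x y z.
Proof.
move=> n0 e.
have e' : (- a) *: hvec x + (- b) *: hvec y + (- c) *: hvec z = 0.
  by rewrite !scaleNr -!opprD e oppr0.
have n0' : ~ [/\ - a = 0, - b = 0 & - c = 0].
  by case=> /eqP + /eqP + /eqP; rewrite !oppr_eq0 => /eqP ? /eqP ? /eqP ?; apply: n0.
wlog ab : a b c n0 e n0' e' / 0 <= a /\ 0 <= b \/ 0 <= a /\ b < 0.
  move=> H; have [a0|a0] := lerP 0 a; have [b0|b0] := lerP 0 b.
  - by apply: (H a b c) => //; left.
  - by apply: (H a b c) => //; right.
  - have [bz|bz] := eqVneq b 0.
      apply: (H (- a) (- b) (- c)) => //; rewrite ?opprK//.
      by left; rewrite bz oppr0; split=> //; rewrite oppr_ge0 ltW.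
    by apply: (H (- a) (- b) (- c)) => //; rewrite ?opprK//; right;
      rewrite oppr_ge0 oppr_lt0 lt_def bz b0; split; first exact: ltW.
  - by apply: (H (- a) (- b) (- c)) => //; rewrite ?opprK//; left;
      rewrite !oppr_ge0; split; exact: ltW.
case: ab => [[a0 b0]|[a0 b0]].
  by apply: Or31; apply: hseg_of_dependent e.
have [c0|c0] := lerP 0 c.
  apply: Or33; apply: (@hseg_of_dependent _ _ _ c a b) => //.
    by case=> ? ? ?; apply: n0.
  by rewrite -[RHS]e; apply/rowP => i; rewrite !mxE; ring.
apply: Or32; apply: (@hseg_of_dependent _ _ _ (- b) (- c) (- a)).
- by rewrite oppr_ge0 ltW.
- by rewrite oppr_ge0 ltW.
- by case=> ? ? ?; apply: n0'.
- by rewrite -[RHS]e'; apply/rowP => i; rewrite !mxE; ring.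
Qed.

(** The three points span a space of dimension at most two; the relation
    between them is Cramer's rule. *)
Lemma hcollinear_hseg x y p q s :
  hseg x y p -> hseg x y q -> hseg x y s -> hcollinear p q s.
Proof.
move=> /hsegP[a1 [b1 [_ _ hp]]] /hsegP[a2 [b2 [_ _ hq]]] /hsegP[a3 [b3 [_ _ hs]]].
have [D|D] := eqVneq (a1 * b2 - a2 * b1) 0; last first.
  apply: (@hcollinear_of_dependent _ _ _ (a2 * b3 - a3 * b2)
    (a3 * b1 - a1 * b3) (a1 * b2 - a2 * b1)).
    by case=> _ _ h; rewrite h eqxx in D.
  by rewrite hp hq hs; apply/rowP => i; rewrite !mxE; ring.
have E : a1 * b2 = a2 * b1 by lra.
have [a0|a0] := eqVneq a1 0; last first.
  apply: (@hcollinear_of_dependent _ _ _ a2 (- a1) 0).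
    by case=> _ /eqP; rewrite oppr_eq0 (negPf a0).
  rewrite hp hq; apply/rowP => i; rewrite !mxE.
  transitivity ((a2 * b1 - a1 * b2) * hvec y 0 i); first by ring.
  by rewrite E subrr mul0r.
have [b0|b0] := eqVneq b1 0; last first.
  apply: (@hcollinear_of_dependent _ _ _ b2 (- b1) 0).
    by case=> _ /eqP; rewrite oppr_eq0 (negPf b0).
  rewrite hp hq; apply/rowP => i; rewrite !mxE.
  transitivity ((a1 * b2 - a2 * b1) * hvec x 0 i); first by ring.
  by rewrite D mul0r.
have := H3_norm p; rewrite hp a0 b0 !scale0r addr0 mink0l => /eqP.
by rewrite eq_sym oppr_eq0 oner_eq0.
Qed.

End Segments.

(** * Convex hulls and their supporting planes *)

Section Hulls.
Variable R : realType.
Implicit Types (S A : set (H3 R)) (v : 'rV[R]_4) (x y z : H3 R) (f : H3 R -> H3 R).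

Lemma hconvex_hhull S : hconvex (hhull S).
Proof.
by move=> x y hx hy z hz A [cA sA]; apply: (cA x y) => //; [apply: hx|apply: hy].
Qed.

Lemma sub_hhull S : S `<=` hhull S.
Proof. exact: sub_gen_smallest. Qed.

Lemma hhull_sub S A : hconvex A -> S `<=` A -> hhull S `<=` A.
Proof. exact: smallest_sub. Qed.

Lemma hconvex_halfspace v : hconvex [set x | mink (hvec x) v <= 0].
Proof.
move=> x y /= hx hy z /hsegP[a [b [a0 b0 e]]] /=; rewrite e !minkE; nra.
Qed.

Lemma hconvex_hplane v : hconvex (hplane v).
Proof.
move=> x y; rewrite /hplane /= => hx hy z /hsegP[a [b [a0 b0 e]]] /=.
by rewrite e !minkE hx hy; ring.
Qed.

(** A vanishing combination of two nonpositive values with nonnegative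
    coefficients has a zero coefficient, which makes [z] an end point, or two
    zero values. *)
Lemma hseg_support v x y z : mink x v <= 0 -> mink y v <= 0 -> mink z v = 0 ->
  hseg x y z -> [\/ z = x, z = y | mink x v = 0 /\ mink y v = 0].
Proof.
move=> hx hy hz /hsegP[a [b [a0 b0 e]]].
have norm_pos (p : H3 R) k : 0 <= k -> hvec z = k *: hvec p -> z = p.
  move=> k0 ek; apply: hvec_inj; suff k1 : k = 1 by rewrite ek k1 scale1r.
  by have := H3_norm z; rewrite ek !minkE H3_norm; nra.
have [az|an] := eqVneq a 0.
  by apply: Or32; apply: (norm_pos _ b); rewrite // e az scale0r add0r.
have [bz|bn] := eqVneq b 0.
  by apply: Or31; apply: (norm_pos _ a); rewrite // e bz scale0r addr0.
have ap : 0 < a by rewrite lt_def an.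
have bp : 0 < b by rewrite lt_def bn.
move: hz; rewrite e !minkE => hz; apply: Or33.
have h1 : a * mink x v <= 0 by rewrite pmulr_rle0.
have h2 : b * mink y v <= 0 by rewrite pmulr_rle0.
have e1 : a * mink x v = 0 by lra.
have e2 : b * mink y v = 0 by lra.
move/eqP: e1; rewrite mulf_eq0 (negPf an) => /eqP ->.
by move/eqP: e2; rewrite mulf_eq0 (negPf bn) => /eqP ->.
Qed.

(** Faces of a hull are hulls of generators.  The points of the half-space that
    belong to [hhull (S `&` hplane v)] whenever they are on the plane form a
    convex set, by [hseg_support], and this set contains [S]. *)
Lemma hhull_support S v : (forall x, S x -> mink x v <= 0) ->
  hhull S `&` hplane v = hhull (S `&` hplane v).
Proof.
move=> hS.
pose A := [set x | mink (hvec x) v <= 0 /\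
  (mink (hvec x) v = 0 -> hhull (S `&` hplane v) x)].
have sA : hhull S `<=` A.
  apply: hhull_sub => [x y [hx Hx] [hy Hy] z hz|x Sx]; last first.
    by split => [|h]; [exact: hS|apply: sub_hhull].
  split; first exact: (hconvex_halfspace hx hy).
  move=> z0; case: (hseg_support hx hy z0 hz) => [e|e|[x0 y0]].
  - by move: z0; rewrite e.
  - by move: z0; rewrite e.
  - exact: (hconvex_hhull (Hx x0) (Hy y0)).
apply/seteqP; split => [x [/sA[_ h] x0]|]; first exact: h.
apply: hhull_sub => [x y [hx px] [hy py] z hz|x [Sx px]]; split => //.
- exact: hconvex_hhull hz.
- exact: hconvex_hplane hz.
- exact: sub_hhull.
Qed.

Lemma hhull_le0 S v : (forall x, S x -> mink x v <= 0) ->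
  forall x, hhull S x -> mink x v <= 0.
Proof. by move=> hS; apply: hhull_sub => //; exact: hconvex_halfspace. Qed.

Lemma hhull_hface S v : 0 < mink v v -> (forall x, S x -> mink x v <= 0) ->
  hface (hhull S) (hhull (S `&` hplane v)).
Proof.
move=> v0 hS; exists v; split => //; first exact: hhull_le0.
by rewrite hhull_support.
Qed.

Lemma hhull2 x y : hhull [set x; y] = hseg x y.
Proof.
apply/seteqP; split.
  apply: hhull_sub => [p q|p [->|->]]; [|exact: hsegl|exact: hsegr].
  move=> /hsegP[a1 [b1 [a10 b10 hp]]] /hsegP[a2 [b2 [a20 b20 hq]]].
  move=> s /hsegP[a [b [a0 b0 hs]]]; apply/hsegP.
  exists (a * a1 + b * a2), (a * b1 + b * b2).
  split; rewrite ?addr_ge0 ?mulr_ge0//.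
  by rewrite hs hp hq; apply/rowP => i; rewrite !mxE; ring.
by move=> z; apply: hconvex_hhull; apply: sub_hhull; [left|right].
Qed.

Lemma hhull1 x : hhull [set x] = [set x].
Proof.
have -> : [set x] = [set x; x] by rewrite setUid.
rewrite hhull2 setUid; apply/seteqP; split => [z|z ->]; last exact: hsegl.
move=> /hsegP[a [b [a0 b0 hz]]]; apply: hvec_inj.
have := H3_norm z; rewrite hz -scalerDl !minkE H3_norm => h.
by rewrite (_ : a + b = 1) ?scale1r//; nra.
Qed.

(** Removing an extreme point outside of the generating set would leave a
    smaller convex set. *)
Lemma hvertex_hhull S : hvertex (hhull S) `<=` S.
Proof.
move=> x [hx ext]; apply: contrapT => nS.
have : (hhull S `\ x) x; last by case=> _; apply.
apply: (@hhull_sub S) => //= [y z [hy ny] [hz nz] w hw|y Sy].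
  split; first exact: (hconvex_hhull hy hz).
  move=> wx; move: hw; rewrite wx => /(ext _ _ hy hz)[e|e].
    by apply: ny; rewrite e.
  by apply: nz; rewrite e.
by split; [exact: sub_hhull|move=> e; apply: nS; rewrite -e].
Qed.

(** A generator that a supporting plane separates from all the others is
    extreme. *)
Lemma hvertex_exposed S v x : (forall y, S y -> mink y v <= 0) ->
  S `&` hplane v = [set x] -> hvertex (hhull S) x.
Proof.
move=> hS e; have [Sx vx] : (S `&` hplane v) x by rewrite e.
split; first exact: sub_hhull.
move=> y z hy hz h.
case: (hseg_support (hhull_le0 hS hy) (hhull_le0 hS hz) vx h); [by left|by right|].
case=> y0 _; left; suff : (hhull S `&` hplane v) y.
  by rewrite hhull_support// e hhull1 => ->.
by split.
Qed.

Lemma hseg_isometry f x y z : hisometry f -> hseg (f x) (f y) (f z) = hseg x y z.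
Proof. by move=> [_ h]; rewrite /hseg /= !h. Qed.

Lemma hhull_isometry f S : hisometry f -> f @` hhull S = hhull (f @` S).
Proof.
move=> isof; have [[g fK gK] _] := isof; apply/seteqP; split.
  move=> _ [x hx <-]; move: x hx.
  apply: (@hhull_sub S (f @^-1` hhull (f @` S))) => [x y hx hy z hz|x Sx] /=.
    by apply: (hconvex_hhull hx hy); rewrite hseg_isometry.
  by apply: sub_hhull; exists x.
apply: hhull_sub => [_ _ [x hx <-] [y hy <-] z|_ [x Sx <-]].
  rewrite -(gK z) hseg_isometry// => h.
  by exists (g z) => //; apply: (hconvex_hhull hx hy).
by exists x => //; apply: sub_hhull.
Qed.

End Hulls.

(** * Cosines of the multiples of pi/n *)

Section Angles.
Variables (R : realType) (n : nat).
Hypothesis n_gt1 : (1 < n)%N.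

Definition step : R := pi / n%:R.
Definition ang (i : nat) : R := i%:R * step.

Let n0 : (n%:R : R) != 0.
Proof. by rewrite pnatr_eq0; lia. Qed.

Lemma step_gt0 : 0 < step.
Proof. by rewrite divr_gt0 ?pi_gt0// ltr0n; lia. Qed.

Lemma ang1 : ang 1 = step.
Proof. by rewrite /ang mul1r. Qed.

Lemma angD i j : ang (i + j) = ang i + ang j.
Proof. by rewrite /ang natrD mulrDl. Qed.

Lemma ang_half : ang n = pi.
Proof. by rewrite /ang /step mulrCA divff// mulr1. Qed.

Lemma ang_turns q : ang (q * n.*2) = pi *+ 2 *+ q.
Proof.
by rewrite /ang natrM -addnn natrD -mulrA mulrDl -/(ang n) ang_half -mulr2n mulr_natl.
Qed.

Lemma ang_lt i j : (i < j)%N -> ang i < ang j.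
Proof. by move=> ij; rewrite /ang ltr_pM2r ?step_gt0// ltr_nat. Qed.

Lemma ang_itv i : (i <= n)%N -> ang i \in `[0, pi].
Proof.
move=> ni; rewrite in_itv/= mulr_ge0//= ?(ltW step_gt0)//.
by rewrite -ang_half /ang ler_pM2r ?step_gt0// ler_nat.
Qed.

Lemma cos_ang_mod d : cos (ang d) = cos (ang (d %% n.*2)).
Proof.
rewrite {1}(divn_eq d n.*2) addnC angD ang_turns.
by rewrite (periodicn (@cosD2pi R)).
Qed.

Lemma cos_ang_fold d : (d <= n.*2)%N -> cos (ang (n.*2 - d)) = cos (ang d).
Proof.
move=> dn; have := angD (n.*2 - d) d; rewrite subnK//.
have := ang_turns 1; rewrite mul1n mulr1n => -> e.
have -> : ang (n.*2 - d) = - ang d + pi *+ 2 by lra.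
by rewrite cosD2pi cosN.
Qed.

Lemma ltr_cos_ang i j : (i <= n)%N -> (j <= n)%N ->
  (cos (ang i) < cos (ang j)) = (j < i)%N.
Proof.
move=> ni nj; rewrite ltr_cos ?ang_itv//.
by rewrite /ang ltr_pM2r ?step_gt0// ltr_nat.
Qed.

Lemma cos_step_lt1 : cos step < 1.
Proof. by rewrite -ang1 -cos0 -[0](mul0r step) -[0 * _]/(ang 0) ltr_cos_ang//; lia. Qed.

Lemma sin_step_gt0 : 0 < sin step.
Proof.
apply: sin_gt0_pi; rewrite step_gt0 -ang_half -ang1.
exact: ang_lt.
Qed.

Lemma cos_step_gtN1 : -1 < cos step.
Proof.
have := sin_step_gt0; have := cos2Dsin2 step; have := cos_step_lt1; nra.
Qed.

Lemma cos_ang_cases d :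
  [\/ (d %% n.*2 = 0)%N /\ cos (ang d) = 1,
      (d %% n.*2 = 1 \/ d.+1 %% n.*2 = 0)%N /\ cos (ang d) = cos step
    | [/\ (d %% n.*2 != 0)%N, (d %% n.*2 != 1)%N, (d.+1 %% n.*2 != 0)%N
      & cos (ang d) < cos step]].
Proof.
rewrite cos_ang_mod -(addn1 d) -(modnDml d).
have : (d %% n.*2 < n.*2)%N by rewrite ltn_mod; lia.
move: (d %% n.*2)%N => e en; rewrite addn1.
have [->|e0] := eqVneq e 0; first by apply: Or31; rewrite /ang mul0r cos0.
have [->|e1] := eqVneq e 1; first by apply: Or32; rewrite ang1; split; [left|].
have [e2|e2] := eqVneq e.+1 n.*2.
  apply: Or32; rewrite e2 modnn; split; first by right.
  have -> : e = (n.*2 - 1)%N by lia.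
  by rewrite cos_ang_fold ?ang1//; lia.
apply: Or33; rewrite modn_small; last by lia.
split => //; have [le|le] := leqP e n.
  by rewrite -ang1 ltr_cos_ang//; lia.
by rewrite -cos_ang_fold 1?ltnW// -ang1 ltr_cos_ang//; lia.
Qed.

(** With indices modulo [2n], the angle [ang l - ang m] is the multiple of
    [step] by a natural number congruent to [l - m]. *)
Lemma cos_angB_cases l m :
  [\/ (l = m %[mod n.*2])%N /\ cos (ang l - ang m) = 1,
      (l = m.+1 %[mod n.*2] \/ l.+1 = m %[mod n.*2])%N
        /\ cos (ang l - ang m) = cos step
    | [/\ (l != m %[mod n.*2])%N, (l != m.+1 %[mod n.*2])%N,
          (l.+1 != m %[mod n.*2])%N & cos (ang l - ang m) < cos step]].
Proof.
pose d := (l + (m * n.*2 - m))%N.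
have dm : (d + m = l + m * n.*2)%N by rewrite /d; nia.
have E k : (k + m * n.*2 = k %[mod n.*2])%N by rewrite modnMDl || rewrite addnC modnMDl.
have e0 : (d %% n.*2 == 0)%N = (l == m %[mod n.*2])%N.
  by rewrite -{1}(mod0n n.*2) -(eqn_modDr m) dm E add0n.
have e1 : (d %% n.*2 == 1)%N = (l == m.+1 %[mod n.*2])%N.
  rewrite -{1}(@modn_small 1 n.*2); last by lia.
  by rewrite -(eqn_modDr m) dm E add1n.
have e2 : (d.+1 %% n.*2 == 0)%N = (l.+1 == m %[mod n.*2])%N.
  by rewrite -{1}(mod0n n.*2) -(eqn_modDr m) addSn dm -addSn E add0n.
have <- : cos (ang d) = cos (ang l - ang m).
  have := angD d m; rewrite dm angD ang_turns => h.
  have -> : ang d = ang l - ang m + pi *+ 2 *+ m by lra.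
  by rewrite (periodicn (@cosD2pi R)).
case: (cos_ang_cases d) => [[h1 h2]|[h1 h2]|[h1 h2 h3 h4]].
- by apply: Or31; split => //; apply/eqP; rewrite -e0 h1.
- apply: Or32; split => //; case: h1 => h1; [left|right]; apply/eqP.
    by rewrite -e1 h1.
  by rewrite -e2 h1.
- by apply: Or33; rewrite -e0 -e1 -e2.
Qed.

Lemma modn_double_odd l m : (l = m %[mod n.*2])%N -> odd l = odd m.
Proof.
move=> e; rewrite (divn_eq l n.*2) (divn_eq m n.*2) e !oddD !oddM !odd_double.
by rewrite !andbF.
Qed.

Lemma cos_angB_eq1 l m : cos (ang l - ang m) = 1 <-> (l = m %[mod n.*2])%N.
Proof.
have lt1 := cos_step_lt1.
case: (cos_angB_cases l m) => [[h1 h2]|[h1 h2]|[/eqP h1 _ _ h2]]; split => //.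
- by rewrite h2 => e; move: lt1; rewrite e ltxx.
- move=> /modn_double_odd e; case: h1 => /modn_double_odd /=; rewrite e;
  by case: (odd m).
- by move=> e; move: (lt_trans h2 lt1); rewrite e ltxx.
Qed.

Lemma cos_angB_le1 l m : cos (ang l - ang m) <= 1.
Proof. by rewrite cos_le1. Qed.

Lemma cos_angB_odd_le l m : odd l != odd m -> cos (ang l - ang m) <= cos step.
Proof.
move=> lm; case: (cos_angB_cases l m) => [[/modn_double_odd h1 h2]|[_ ->]//|[_ _ _ /ltW//]].
by rewrite h1 eqxx in lm.
Qed.

Lemma cos_angB_step l m : cos (ang l - ang m) = cos step <->
  (l = m.+1 %[mod n.*2] \/ l.+1 = m %[mod n.*2])%N.
Proof.
have lt1 := cos_step_lt1.
case: (cos_angB_cases l m) => [[h1 h2]|[h1 h2]|[/eqP h1 /eqP h2 /eqP h3 h4]].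
- split; first by rewrite h2 => e; move: lt1; rewrite -e ltxx.
  move/modn_double_odd: h1 => h1.
  by case=> /modn_double_odd /=; rewrite h1; case: (odd m).
- by [].
- by split => [e|[]//]; move: h4; rewrite e ltxx.
Qed.

(** A vector [(a, b)] of the plane with equal scalar products with the unit
    vectors of angles [ang i] and [ang j] lies on their bisector, whose angle
    is again a multiple of [step] when [i] and [j] have the same parity.  The
    sign of [A] is absorbed by a half-turn, that is, by adding [n] to [m]. *)
Lemma bisector_direction (a b : R) i j :
  (i < j < n.*2)%N -> odd i = odd j ->
  a * cos (ang i) + b * sin (ang i) = a * cos (ang j) + b * sin (ang j) ->
  exists m A, [/\ 0 <= A, a = A * cos (ang m) & b = A * sin (ang m)].
Proof.
move=> /andP[ij jn] oij e.
pose m := ((i + j)./2)%N; pose k := ((j - i)./2)%N.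
have mij : (m.*2 = i + j)%N by rewrite /m -[RHS]odd_double_half oddD oij addbb.
have kij : (k.*2 = j - i)%N.
  by rewrite /k -[RHS]odd_double_half oddB ?(ltnW ij)// oij addbb.
have jE : j = (m + k)%N by lia.
have mE : m = (i + k)%N by lia.
have := angD m k; rewrite -jE => aj.
have := angD i k; rewrite -mE => /(congr1 (fun t => t - ang k)).
rewrite addrK => /esym ai; rewrite aj ai cosB cosD sinB sinD in e.
have sk : sin (ang k) != 0.
  rewrite lt0r_neq0// sin_gt0_pi// -[X in X < _](mul0r step) -/(ang 0).
  by rewrite -ang_half !ang_lt//; lia.
have ab : a * sin (ang m) = b * cos (ang m).
  by apply: (mulIf sk); lra.
have cs := cos2Dsin2 (ang m).
pose A := a * cos (ang m) + b * sin (ang m).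
have aA : a = A * cos (ang m).
  by rewrite -[LHS]mulr1 -cs /A mulrDr !expr2 !mulrA ab; ring.
have bA : b = A * sin (ang m).
  by rewrite -[LHS]mulr1 -cs /A mulrDr !expr2 !mulrA -ab; ring.
have [A0|A0] := lerP 0 A; first by exists m, A.
exists (m + n)%N, (- A); rewrite angD ang_half cosDpi sinDpi oppr_ge0 ltW//.
by rewrite !mulrNN.
Qed.

End Angles.

(** * Mirror rotations *)

Section MirrorRotation.
Variable R : realType.
Implicit Types (u v : 'rV[R]_4) (x y z : H3 R) (phi : R).

Let e1 : 'rV[R]_4 := vec4 0 1 0 0.
Let e2 : 'rV[R]_4 := vec4 0 0 1 0.
Let e3 : 'rV[R]_4 := vec4 0 0 0 1.

Definition mrot_vec phi u : 'rV[R]_4 := hrefl e3 (hrot e1 e2 phi u).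

Lemma mrot_vec4 phi t a b c : mrot_vec phi (vec4 t a b c) =
  vec4 t (cos phi * a - sin phi * b) (sin phi * a + cos phi * b) (- c).
Proof.
rewrite /mrot_vec /hrefl /hrot !minkE !mink_vec4; apply/rowP => i; rewrite !mxE.
by case: i => [[|[|[|[|//]]]]] ? /=; ring.
Qed.

Lemma mink_mrot phi u v : mink (mrot_vec phi u) (mrot_vec phi v) = mink u v.
Proof.
have [t [a [b [c ->]]]] := vec4_eta u.
have [t' [a' [b' [c' ->]]]] := vec4_eta v.
rewrite !mrot_vec4 !mink_vec4.
transitivity ((cos phi ^+ 2 + sin phi ^+ 2) * (a * a' + b * b') + c * c' - t * t').
  by ring.
by rewrite cos2Dsin2; ring.
Qed.

Lemma mrot_subproof phi x : let u := mrot_vec phi x in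
  (mink u u == -1) && (0 < u 0 ord0).
Proof.
rewrite /= mink_mrot H3_norm eqxx /=; have := H3_time_gt0 x.
by have [t [a [b [c ->]]]] := vec4_eta (hvec x); rewrite mrot_vec4 !mxE.
Qed.

Definition mrot phi x : H3 R := mkH3 (mrot_subproof phi x).

Lemma mrotK phi : cancel (mrot phi) (mrot (- phi)).
Proof.
move=> x; apply: hvec_inj; rewrite /=.
have [t [a [b [c ->]]]] := vec4_eta (hvec x).
rewrite !mrot_vec4 cosN sinN opprK.
have cs := cos2Dsin2 phi.
congr vec4.
  rewrite -[RHS]mul1r -cs; ring.
rewrite -[RHS]mul1r -cs; ring.
Qed.

Lemma mrot_hisometry phi : hisometry (mrot phi).
Proof.
split; last by move=> x y; rewrite /hdist mink_mrot.
exists (mrot (- phi)); first exact: mrotK.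
by move=> x; rewrite -{1}(opprK phi) mrotK.
Qed.

Lemma hmirror_rotation_mrot phi : hmirror_rotation phi (mrot phi).
Proof.
exists e1, e2, e3; split=> [|x //].
by rewrite /spacelike_orthonormal !mink_vec4; do 2!split; ring.
Qed.

Lemma hisometry_iter (f : H3 R -> H3 R) k : hisometry f -> hisometry (iter k f).
Proof.
move=> isof; elim: k => [|k [bk ik]]; first by split => //; exists id.
have [bf isf] := isof; split => [|x y /=]; last by rewrite isf ik.
exact: (bij_comp bf bk).
Qed.

Lemma hangle_mink x y z x' y' z' :
  mink x y = mink x' y' -> mink y z = mink y' z' -> mink x z = mink x' z' ->
  hangle x y z = hangle x' y' z'.
Proof.
move=> hxy hyz hxz; rewrite /hangle /htangent !minkE !H3_norm.
by rewrite !(minkC y x) !(minkC z y) !(minkC y' x') !(minkC z' y') !hxy !hyz !hxz.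
Qed.

End MirrorRotation.

(** * The vertices of the antiprism and its supporting planes *)

Section Configuration.
Variables (R : realType) (n : nat) (r h : R).
Hypotheses (n_ge3 : (3 <= n)%N) (r_gt0 : 0 < r) (h_neq0 : h != 0).

Let n_gt1 : (1 < n)%N. Proof. exact: ltnW. Qed.
Let rn0 : r != 0. Proof. exact: lt0r_neq0. Qed.

Local Notation phi := (step R n).
Local Notation "'ang" := (ang R n).

Let T : R := Num.sqrt (1 + r ^+ 2 + h ^+ 2).

Let T2 : T ^+ 2 = 1 + r ^+ 2 + h ^+ 2.
Proof. by rewrite sqr_sqrtr//; have := sqr_ge0 r; have := sqr_ge0 h; lra. Qed.

Let T0 : 0 < T.
Proof. by rewrite sqrtr_gt0; have := sqr_ge0 r; have := sqr_ge0 h; lra. Qed.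

(** On the hyperboloid [r] and [h] are the hyperbolic sines of the distances
    from the vertices to the axis and to the plane of symmetry. *)
Definition vert_vec i : 'rV[R]_4 :=
  vec4 T (r * cos ('ang i)) (r * sin ('ang i)) ((-1) ^+ i * h).

Lemma mink_vert_vec i j : mink (vert_vec i) (vert_vec j) =
  r ^+ 2 * cos ('ang i - 'ang j) + (-1) ^+ (i + j) * h ^+ 2 - T ^+ 2.
Proof. by rewrite mink_vec4 cosB exprD; ring. Qed.

Lemma vert_subproof i :
  (mink (vert_vec i) (vert_vec i) == -1) && (0 < vert_vec i 0 ord0).
Proof.
rewrite mink_vert_vec subrr cos0 addnn -mul2n exprM sqrrN !expr1n T2.
by rewrite mxE /= T0 andbT; apply/eqP; ring.
Qed.

Definition vert i : H3 R := mkH3 (vert_subproof i).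
Local Notation V := vert.

Lemma mink_vert i j : mink (V i) (V j) =
  r ^+ 2 * cos ('ang i - 'ang j) + (-1) ^+ (i + j) * h ^+ 2 - T ^+ 2.
Proof. exact: mink_vert_vec. Qed.

Lemma mink_vertD i j : mink (V i) (V (i + j)) =
  r ^+ 2 * cos ('ang j) + (-1) ^+ j * h ^+ 2 - T ^+ 2.
Proof.
rewrite mink_vert angD opprD addrA subrr add0r cosN addnA addnn exprD.
by rewrite -mul2n exprM sqrrN !expr1n mul1r.
Qed.

Lemma mink_vertS i : mink (V i) (V i.+1) =
  - (1 + r ^+ 2 * (1 - cos phi) + 2 * h ^+ 2).
Proof. by rewrite -(addn1 i) mink_vertD ang1 T2; ring. Qed.

Lemma mink_vertSS i : mink (V i) (V i.+2) =
  - (1 + 2 * r ^+ 2 * (1 - cos phi ^+ 2)).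
Proof.
rewrite -(addn2 i) mink_vertD (_ : 'ang 2 = phi *+ 2).
  by rewrite cos_mulr2n T2; ring.
by rewrite /ang mulr_natl.
Qed.

(** The coordinates are scaled so that the linear form [mink _ (normal m A B C)]
    takes on the vertices values that do not involve [r] and [h], which gives
    one formula for all the supporting planes that are needed. *)
Definition normal m (A B C : R) : 'rV[R]_4 :=
  vec4 (C / T) (A * cos ('ang m) / r) (A * sin ('ang m) / r) ((-1) ^+ m * B / h).

Lemma mink_normal l m A B C : mink (V l) (normal m A B C) =
  A * cos ('ang l - 'ang m) + (-1) ^+ (l + m) * B - C.
Proof.
rewrite mink_vec4 cosB exprD; field.
by rewrite h_neq0 rn0 lt0r_neq0.
Qed.

Lemma sign_addnn m : (-1) ^+ (m + m) = 1 :> R.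
Proof. by rewrite addnn -mul2n exprM sqrrN !expr1n. Qed.

Lemma sign_parity l m :
  (-1) ^+ (l + m) = (if odd l == odd m then 1 else -1) :> R.
Proof. by rewrite -signr_odd oddD; case: (odd l); case: (odd m); rewrite ?expr0 ?expr1. Qed.

Lemma mink_normal_same l m A B C : odd l = odd m ->
  mink (V l) (normal m A B C) = A * cos ('ang l - 'ang m) + B - C.
Proof. by move=> e; rewrite mink_normal sign_parity e eqxx mul1r. Qed.

Lemma mink_normal_diff l m A B C : odd l != odd m ->
  mink (V l) (normal m A B C) = A * cos ('ang l - 'ang m) - B - C.
Proof. by move=> /negPf e; rewrite mink_normal sign_parity e mulN1r. Qed.

(** Both terms of the form [mink _ (normal m 1 1 2)] are maximal at [V m], and
    the cosine is maximal there only; this makes [V m] an extreme point. *)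
Lemma vertex_support l m : mink (V l) (normal m 1 1 2) <= 0.
Proof.
rewrite mink_normal mul1r mulr1 sign_parity.
by have := cos_angB_le1 R n l m; case: ifP => _; lra.
Qed.

Lemma vertex_support_eq0 l m :
  mink (V l) (normal m 1 1 2) = 0 <-> (l = m %[mod n.*2])%N.
Proof.
have := cos_angB_le1 R n l m; split.
  rewrite mink_normal mul1r mulr1 sign_parity => e; apply/(cos_angB_eq1 R n_gt1).
  by move: e; case: ifP => _; lra.
move=> e; rewrite mink_normal_same ?(modn_double_odd e)//.
by rewrite (proj2 (cos_angB_eq1 R n_gt1 l m) e); ring.
Qed.

(** For the lateral face [V m.-1], [V m], [V m.+1]: the coefficients solve
    [A + B - C = 0] (the value at [V m]) and [A * cos phi - B - C = 0] (the
    value at its two neighbours), normalized by [A = 2]. *)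
Definition lateral_normal m := normal m 2 (cos phi - 1) (1 + cos phi).

Lemma lateral_support l m : mink (V l) (lateral_normal m) <= 0.
Proof.
have [e|e] := eqVneq (odd l) (odd m).
  by rewrite mink_normal_same//; have := cos_angB_le1 R n l m; lra.
by rewrite mink_normal_diff//; have := cos_angB_odd_le R n_gt1 e; lra.
Qed.

Lemma lateral_support_eq0 l m : mink (V l) (lateral_normal m) = 0 <->
  [\/ l = m %[mod n.*2], l = m.+1 %[mod n.*2] | l.+1 = m %[mod n.*2]]%N.
Proof.
split.
  have [e|e] := eqVneq (odd l) (odd m).
    rewrite mink_normal_same// => h0; apply: Or31.
    by apply/(cos_angB_eq1 R n_gt1); lra.
  rewrite mink_normal_diff// => h0.
  have : cos ('ang l - 'ang m) = cos phi by lra.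
  by move/(cos_angB_step R n_gt1) => [?|?]; [apply: Or32|apply: Or33].
case=> [e|e|e].
- rewrite mink_normal_same ?(modn_double_odd e)//.
  by rewrite (proj2 (cos_angB_eq1 R n_gt1 l m) e); ring.
- have /(cos_angB_step R n_gt1) c : (l = m.+1 %[mod n.*2] \/ l.+1 = m %[mod n.*2])%N by left.
  rewrite mink_normal_diff ?c; first by ring.
  by rewrite (modn_double_odd e) /=; case: (odd m).
- have /(cos_angB_step R n_gt1) c : (l = m.+1 %[mod n.*2] \/ l.+1 = m %[mod n.*2])%N by right.
  rewrite mink_normal_diff ?c; first by ring.
  by rewrite -(modn_double_odd e) /=; case: (odd l).
Qed.

(** With [A = 0] the form is constant on each base, and it vanishes on the one
    that contains [V m]. *)
Lemma base_support l m : mink (V l) (normal m 0 1 1) <= 0.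
Proof. by rewrite mink_normal sign_parity; case: ifP => _; lra. Qed.

Lemma base_support_eq0 l m : mink (V l) (normal m 0 1 1) = 0 <-> odd l = odd m.
Proof.
rewrite mink_normal sign_parity; have [e|e] := eqVneq (odd l) (odd m).
  by split => // _; ring.
by split => [|/eqP e']; [lra|rewrite e' in e].
Qed.

(** This plane cuts the base that does not contain [V m] along its side from
    [V m.-1] to [V m.+1]; it supports this base, not the whole antiprism. *)
Lemma side_support l m : odd l != odd m -> mink (V l) (normal m 1 0 (cos phi)) <= 0.
Proof.
by move=> e; rewrite mink_normal_diff//; have := cos_angB_odd_le R n_gt1 e; lra.
Qed.

Lemma side_support_eq0 l m : odd l != odd m ->
  mink (V l) (normal m 1 0 (cos phi)) = 0 <->
  (l = m.+1 %[mod n.*2] \/ l.+1 = m %[mod n.*2])%N.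
Proof.
move=> e; rewrite mink_normal_diff//.
by split => [h0|/(cos_angB_step R n_gt1) ->]; [apply/(cos_angB_step R n_gt1)|]; lra.
Qed.

Lemma vert_eq i j : V i = V j <-> (i = j %[mod n.*2])%N.
Proof.
split=> [e|e].
  by apply/vertex_support_eq0; rewrite e; apply/vertex_support_eq0.
apply: H3_eq; rewrite mink_vert (proj2 (cos_angB_eq1 R n_gt1 i j) e).
by rewrite sign_parity (modn_double_odd e) eqxx T2; ring.
Qed.

Lemma vert_periodic i : V (i + n.*2) = V i.
Proof. by apply/vert_eq; rewrite -{1}(mul1n n.*2) addnC modnMDl. Qed.

Lemma vert_mod i : V (i %% n.*2) = V i.
Proof. by apply/vert_eq; rewrite modn_mod. Qed.

Lemma mrot_vert i : mrot phi (V i) = V i.+1.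
Proof.
apply: hvec_inj; rewrite /= mrot_vec4 /vert_vec -(addn1 i) angD ang1 cosD sinD exprD expr1.
by congr vec4; ring.
Qed.

Lemma iter_mrot_vert k i : iter k (mrot phi) (V i) = V (i + k).
Proof. by elim: k => [|k IH] /=; rewrite ?addn0// IH mrot_vert addnS. Qed.

(** A vector whose scalar products with two vertices of the same base agree is
    a [normal]: its horizontal part is directed along the bisector. *)
Lemma normal_of_equal_values v i j : ~ (i = j %[mod n.*2])%N -> odd i = odd j ->
  mink (V i) v = mink (V j) v -> exists m A B C, 0 <= A /\ v = normal m A B C.
Proof.
move=> ij oij e.
have n20 : (0 < n.*2)%N by lia.
have {ij oij e} [a [b [ab oab e]]] :
    exists a b, [/\ (a < b < n.*2)%N, odd a = odd b & mink (V a) v = mink (V b) v].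
  have o k : odd (k %% n.*2) = odd k by apply: modn_double_odd (modn_mod _ _).
  have := ltn_mod i n.*2; have := ltn_mod j n.*2; rewrite n20 => jn in_.
  case: (ltngtP (i %% n.*2) (j %% n.*2)) => [lt|lt|//].
    by exists (i %% n.*2)%N, (j %% n.*2)%N; rewrite lt jn !o !vert_mod.
  by exists (j %% n.*2)%N, (i %% n.*2)%N; rewrite lt in_ !o !vert_mod.
have [t [x [y [z vE]]]] := vec4_eta v.
have [] := @bisector_direction R n n_gt1 x y a b ab oab.
  move: e; rewrite vE !mink_vec4 -signr_odd oab signr_odd => e.
  by apply: (mulfI rn0); lra.
move=> m [A [A0 xA yA]]; exists m, (A * r), ((-1) ^+ m * h * z), (T * t).
split; first by rewrite mulr_ge0// ltW.
have sm : (-1) ^+ m * (-1) ^+ m = 1 :> R by rewrite -exprD sign_addnn.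
rewrite vE /normal xA yA; congr vec4; rewrite ?mulrA ?sm; field => //.
by rewrite lt0r_neq0.
Qed.

(** Supporting planes through two vertices of the same base.  With
    [v = normal m A B C] and [0 < A] the vertices of each parity that are
    closest to the direction [ang m] maximize the form [mink _ v]: this is
    [V m] alone for the parity of [m], and the pair [V m.-1], [V m.+1] for the
    other one.  With [A = 0] the form is constant on each base. *)
Lemma support_classification v i j : 0 < mink v v ->
  (forall l, mink (V l) v <= 0) -> ~ (i = j %[mod n.*2])%N -> odd i = odd j ->
  mink (V i) v = 0 -> mink (V j) v = 0 ->
  (forall l, mink (V l) v = 0 <-> odd l = odd i) \/
  exists m, [/\ odd i != odd m,
    forall l, (l = m.+1 %[mod n.*2] \/ l.+1 = m %[mod n.*2])%N -> mink (V l) v = 0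
    & forall l, mink (V l) v = 0 ->
     [\/ l = m %[mod n.*2], l = m.+1 %[mod n.*2] | l.+1 = m %[mod n.*2]]%N].
Proof.
move=> v0 le0 ij oij iv jv.
have [m [A [B [C [A0 vE]]]]] := normal_of_equal_values ij oij (etrans iv (esym jv)).
move: v0 le0 iv jv; rewrite vE => v0 le0 iv jv.
have [Az|An] := eqVneq A 0.
  left=> l; split => [lv|ol].
    apply/eqP; apply: contraPeq v0 => oli.
    have [-> ->] : B = 0 /\ C = 0.
      move: lv iv; rewrite !mink_normal !sign_parity Az !mul0r !add0r.
      by move: oli; case: (odd l); case: (odd i) => // _; case: (odd m) => /= h1 h2;
        split; lra.
    by rewrite Az /normal !(mulr0, mul0r) mink_vec4 !mulr0 !addr0 subrr ltxx.
  by rewrite -[RHS]iv !mink_normal !sign_parity ol Az !mul0r.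
have Ap : 0 < A by rewrite lt_def An.
have same l : odd l = odd m -> mink (V l) (normal m A B C) = 0 -> (l = m %[mod n.*2])%N.
  move=> olm; have := le0 m; rewrite !mink_normal_same// subrr cos0 => hm hl.
  apply/(cos_angB_eq1 R n_gt1); apply/le_anti/andP; split; first exact: cos_angB_le1.
  by rewrite -(ler_pM2l Ap); lra.
have oim : odd i != odd m.
  apply/eqP => oim; apply: ij.
  by rewrite (same i)// (same j)// -oij.
have top : A * cos phi - B - C = 0.
  have := le0 m.+1; rewrite mink_normal_diff /=; last by case: (odd m).
  have /(cos_angB_step R n_gt1) -> : (m.+1 = m.+1 %[mod n.*2] \/ m.+2 = m %[mod n.*2])%N by left.
  move: iv; rewrite mink_normal_diff//.
  have := cos_angB_odd_le R n_gt1 oim; rewrite -(ler_pM2l Ap); lra.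
right; exists m; split => // l.
  move=> e; rewrite mink_normal_diff; first by rewrite (proj2 (cos_angB_step R n_gt1 l m) e).
  case: e => /modn_double_odd /=; first by move=> ->; case: (odd m).
  by move=> <-; case: (odd l).
move=> lv; have [e|e] := eqVneq (odd l) (odd m); first by apply: Or31; apply: same.
have : cos ('ang l - 'ang m) = cos phi.
  by apply: (mulfI An); move: lv; rewrite mink_normal_diff//; lra.
by move/(cos_angB_step R n_gt1) => [?|?]; [apply: Or32|apply: Or33].
Qed.

Local Notation parity b := [set i | odd i = b].
Local Notation P := (hhull (range V)).

Lemma modn_offset i a b : (a < n.*2)%N -> (b < n.*2)%N ->
  (i + a = i + b %[mod n.*2])%N -> a = b.
Proof. by move=> an bn /eqP; rewrite eqn_modDl !modn_small// => /eqP. Qed.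

Lemma vert_hvertex (I : set nat) i : I i -> hvertex (hhull (V @` I)) (V i).
Proof.
move=> Ii; apply: (@hvertex_exposed _ _ (normal i 1 1 2)) => [_ [l _ <-]|].
  exact: vertex_support.
apply/seteqP; split => [_ [[l _ <-] /vertex_support_eq0/vert_eq //]|_ ->].
by split; [exists i|apply/vertex_support_eq0].
Qed.

Lemma hvertex_verts (I : set nat) : hvertex (hhull (V @` I)) = V @` I.
Proof.
apply/seteqP; split; first exact: hvertex_hhull.
by move=> _ [i Ii <-]; exact: vert_hvertex.
Qed.

Lemma hseg_verts i j k : hseg (V i) (V j) (V k) -> V k = V i \/ V k = V j.
Proof. by apply: (vert_hvertex (I := setT) (i := k) I).2; apply: sub_hhull; eexists. Qed.

Lemma verts_not_collinear i j k : V i <> V j -> V j <> V k -> V k <> V i ->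
  ~ hcollinear (V i) (V j) (V k).
Proof. by move=> ij jk ki [] /hseg_verts[] e; [exact: ki|apply: jk|apply: ij|apply: ki|apply: jk|apply: ij]. Qed.

Lemma offset_verts_not_collinear i a b c : (a < b < c)%N -> (c < n.*2)%N ->
  ~ hcollinear (V (i + a)) (V (i + b)) (V (i + c)).
Proof.
move=> abc cn; apply: verts_not_collinear => /vert_eq /modn_offset; lia.
Qed.

Lemma verts_face v : 0 < mink v v -> (forall l, mink (V l) v <= 0) ->
  hface P (hhull (V @` [set l | mink (V l) v = 0])).
Proof.
move=> v0 le0; suff -> : V @` [set l | mink (V l) v = 0] = range V `&` hplane v.
  by apply: hhull_hface => // _ [l _ <-].
apply/seteqP; split => [_ [l lv <-]|_ [[l _ <-] lv]]; last by exists l.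
by split => //; exists l.
Qed.

Lemma base_hfacet (b : bool) : hfacet P (hhull (V @` parity b)).
Proof.
split.
  pose v := normal b 0 1 1.
  suff -> : parity b = [set l | mink (V l) v = 0].
    apply: verts_face => [|l]; last exact: base_support.
    apply: (@spacelike_of_orth _ (V b) (V b.+1)); first exact/base_support_eq0.
    by apply/eqP => /base_support_eq0 /=; case: (odd b).
  apply/seteqP; split => l /=; rewrite base_support_eq0 oddb; exact.
exists (V (b + 0)), (V (b + 2)), (V (b + 4)).
have mem k : odd k = false -> hhull (V @` parity b) (V (b + k)).
  by move=> ok; apply: sub_hhull; exists (b + k)%N => //=; rewrite oddD oddb ok addbF.
by split; try exact: mem; apply: offset_verts_not_collinear => //; lia.
Qed.

Lemma lateral_zero_set m (v : 'rV[R]_4) :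
  (forall l, mink (V l) v = 0 <->
    [\/ l = m.+1 %[mod n.*2], l = m.+2 %[mod n.*2] | l.+1 = m.+1 %[mod n.*2]]%N) ->
  V @` [set l | mink (V l) v = 0] = [set V m; V m.+1; V m.+2].
Proof.
move=> hv; apply/seteqP; split => [_ [l lv <-]|_ [[]|] ->].
- have /hv [e|e|/eqP e] := lv.
  + by left; right; apply/vert_eq.
  + by right; apply/vert_eq.
  + by left; left; apply/vert_eq/eqP; rewrite -(eqn_modDr 1) !addn1.
- by exists m => //=; apply/hv/Or33.
- by exists m.+1 => //=; apply/hv/Or31.
- by exists m.+2 => //=; apply/hv/Or32.
Qed.

Lemma lateral_hfacet m : hfacet P (lateral_face V m).
Proof.
rewrite /lateral_face -(@lateral_zero_set m (lateral_normal m.+1)); last first.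
  by move=> l; rewrite lateral_support_eq0.
split; last first.
  exists (V (m + 0)), (V (m + 1)), (V (m + 2)).
  split; last by apply: offset_verts_not_collinear => //; lia.
  + apply: sub_hhull; exists (m + 0)%N => //=; apply/lateral_support_eq0/Or33; by rewrite addn0.
  + apply: sub_hhull; exists (m + 1)%N => //=; apply/lateral_support_eq0/Or31; by rewrite addn1.
  + apply: sub_hhull; exists (m + 2)%N => //=; apply/lateral_support_eq0/Or32; by rewrite addn2.
apply: verts_face => [|l]; last exact: lateral_support.
apply: (@spacelike_of_orth _ (V m.+1) (V (m + 3))).
  by apply/lateral_support_eq0/Or31.
apply/eqP => /lateral_support_eq0[].
- by rewrite -(addn1 m) => /modn_offset; lia.
- by rewrite -(addn2 m) => /modn_offset; lia.
- by rewrite -addnS -(addn1 m) => /modn_offset; lia.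
Qed.

Lemma hfacet_third_vertex v (x y z : H3 R) p q :
  (P `&` hplane v) x -> (P `&` hplane v) y -> (P `&` hplane v) z ->
  ~ hcollinear x y z -> (forall l, mink (V l) v <= 0) ->
  exists l, [/\ mink (V l) v = 0, V l <> p & V l <> q].
Proof.
move=> Fx Fy Fz ncol le0; apply: contrapT => nex; apply: ncol.
have sub : P `&` hplane v `<=` hseg p q.
  rewrite hhull_support; last by move=> _ [l _ <-].
  rewrite -hhull2; apply: hhull_sub; first exact: hconvex_hhull.
  move=> _ [[l _ <-] lv]; apply: sub_hhull; apply: contrapT => npq.
  by apply: nex; exists l; split => // e; apply: npq; [left|right].
exact: hcollinear_hseg (sub _ Fx) (sub _ Fy) (sub _ Fz).
Qed.

(** A facet contains three vertices, two of which lie on the same base, so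
    that [support_classification] applies; its second case is a lateral face
    because the third vertex has to be [V m]. *)
Lemma hfacet_cases F : hfacet P F ->
  [\/ F = hhull (V @` parity true), F = hhull (V @` parity false)
    | exists i, F = lateral_face V i].
Proof.
move=> [[v [v0 leP FE]] [x [y [z [Fx Fy Fz ncol]]]]].
have le0 l : mink (V l) v <= 0 by apply: leP; apply: sub_hhull; exists l.
rewrite {}FE in Fx Fy Fz *.
have third p q := hfacet_third_vertex p q Fx Fy Fz ncol le0.
have -> : P `&` hplane v = hhull (V @` [set l | mink (V l) v = 0]).
  rewrite hhull_support; last by move=> _ [l _ <-].
  congr hhull; apply/seteqP; split => [_ [[l _ <-] lv]|_ [l lv <-]].
    by exists l.
  by split => //; exists l.
have [i [j [k [[iv jv kv] [ij ik jk] oij]]]] : exists i j k,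
    [/\ [/\ mink (V i) v = 0, mink (V j) v = 0 & mink (V k) v = 0],
        [/\ V i <> V j, V i <> V k & V j <> V k] & odd i = odd j].
  have [i [iv _ _]] := third (V 0) (V 0).
  have [j [jv ji _]] := third (V i) (V i).
  have [k [kv ki kj]] := third (V i) (V j).
  have [oij|oij] := eqVneq (odd i) (odd j).
    by exists i, j, k; do !split => //; apply/nesym.
  have [oik|oik] := eqVneq (odd i) (odd k).
    by exists i, k, j; do !split => //; apply/nesym.
  exists j, k, i; do !split => //; try exact/nesym.
  by move: oij oik; case: (odd i); case: (odd j); case: (odd k).
have ij' : ~ (i = j %[mod n.*2])%N by move=> /vert_eq.
case: (support_classification v0 le0 ij' oij iv jv) => [par|[m [oim zero zeros]]].
  have -> : [set l | mink (V l) v = 0] = parity (odd i).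
    by apply/seteqP; split => l /par.
  by case: (odd i); [apply: Or31|apply: Or32].
pose m' := (m + n.*2.-1)%N.
have m'E : (m'.+1 = m %[mod n.*2])%N.
  by rewrite /m' -addnS prednK ?modnDr//; lia.
have mv : mink (V m) v = 0.
  have neighb l : mink (V l) v = 0 -> V l <> V m ->
      (l = m.+1 %[mod n.*2] \/ l.+1 = m %[mod n.*2])%N.
    by move=> /zeros[/vert_eq//|?|?] _; [left|right].
  have [<-//|km] := pselect (V k = V m).
  have im : V i <> V m by move=> /vert_eq/modn_double_odd e; rewrite e eqxx in oim.
  have jm : V j <> V m.
    by move=> /vert_eq/modn_double_odd e; rewrite oij e eqxx in oim.
  have S1 a b : (a.+1 = m %[mod n.*2])%N -> (b.+1 = m %[mod n.*2])%N -> V a = V b.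
    move=> ea eb; apply/vert_eq/eqP; rewrite -(eqn_modDr 1) !addn1.
    by apply/eqP; rewrite ea eb.
  have S2 a b : (a = m.+1 %[mod n.*2])%N -> (b = m.+1 %[mod n.*2])%N -> V a = V b.
    by move=> ea eb; apply/vert_eq; rewrite ea eb.
  case: (neighb _ iv im) (neighb _ jv jm) (neighb _ kv km) => ei [] ej [] ek.
  - by case: ij; apply: S2.
  - by case: ij; apply: S2.
  - by case: ik; apply: S2.
  - by case: jk; apply: S1.
  - by case: jk; apply: S2.
  - by case: ik; apply: S1.
  - by case: ij; apply: S1.
  - by case: ij; apply: S1.
apply: Or33; exists m'; rewrite /lateral_face; congr hhull.
have m''E : (m'.+2 = m.+1 %[mod n.*2])%N.
  by apply/eqP; rewrite -[m'.+2]addn1 -[m.+1]addn1 eqn_modDr; apply/eqP.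
apply: lateral_zero_set => l; rewrite m'E m''E; split; first exact: zeros.
case=> [/vert_eq ->//|e|e]; apply: zero; by [left|right].
Qed.

Lemma hpolyhedron_hull : hpolyhedron P.
Proof.
split.
  exists (range V) => //; apply: (@sub_finite_set _ _ (V @` `I_n.*2)).
    move=> _ [i _ <-]; exists (i %% n.*2)%N; last exact: vert_mod.
    by rewrite /= ltn_mod; lia.
  exact/finite_image/finite_II.
move=> v v0 sub; have zero l : mink (V l) v = 0 by apply: sub; apply: sub_hhull; exists l.
have le0 l : mink (V l) v <= 0 by rewrite zero.
have n02 : ~ (0 = 2 %[mod n.*2])%N by rewrite !modn_small//; lia.
case: (support_classification v0 le0 n02 erefl (zero _) (zero _)) => [par|].
  by have /par := zero 1.
case=> m [_ _ /(_ (m + 3)%N (zero _))] [].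
- by rewrite -[X in (_ = X %[mod _])%N -> _]addn0 => /modn_offset; lia.
- by rewrite -[X in (_ = X %[mod _])%N -> _]addn1 => /modn_offset; lia.
- by rewrite -addnS -[X in (_ = X %[mod _])%N -> _]addn0 => /modn_offset; lia.
Qed.

Lemma cyclic_enum_verts : cyclic_enum n.*2 V (hvertex P).
Proof.
rewrite hvertex_verts; split; first exact: vert_periodic.
split => [i _|i j|_ [i _ <-]]; first by exists i.
  by rewrite !inE /= => i2 j2 /vert_eq; rewrite !modn_small.
exists (i %% n.*2)%N; last exact: vert_mod.
by rewrite /= ltn_mod; lia.
Qed.

Lemma base_regular_polygon (b : bool) :
  regular_polygon n (fun j => V (b + j.*2)) (hhull (V @` parity b)).
Proof.
have parE k : odd (b + k.*2) = b by rewrite oddD oddb odd_double addbF.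
have imE : V @` parity b = range (fun j => V (b + j.*2)).
  apply/seteqP; split => [_ [i /= oi <-]|_ [j _ <-]].
    by exists i./2 => //; rewrite -oi odd_double_half.
  by exists (b + j.*2)%N => //=; exact: parE.
split.
- rewrite hvertex_verts; split=> [i|]; first by rewrite doubleD addnA vert_periodic.
  split => [i _|i j|_ [i /= oi <-]]; first by rewrite imE; exists i.
    rewrite !inE /= => i2 j2 /vert_eq/modn_offset/=; lia.
  have o : odd (i %% n.*2) = b by rewrite (modn_double_odd (modn_mod _ _)).
  have lt : (i %% n.*2 < n.*2)%N by rewrite ltn_mod; lia.
  exists (i %% n.*2)./2%N; first by rewrite /=; lia.
  by rewrite -{1}o odd_double_half vert_mod.
- by rewrite imE.
- move=> i; pose m := (b + i.*2).+1; pose v := normal m 1 0 (cos phi).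
  have om l : odd l = b -> odd l != odd m by rewrite /= parE => ->; case: (b).
  have E : V @` parity b `&` hplane v = [set V (b + i.*2); V (b + i.+1.*2)].
    apply/seteqP; split => [_ [[l /= ol <-]]|_ [->|->]].
    + move=> /(side_support_eq0 (om _ ol)) [e|e]; [right|left]; apply/vert_eq.
        by rewrite e doubleS !addnS.
      by apply/eqP; rewrite -(eqn_modDr 1) !addn1; apply/eqP.
    + split; first by exists (b + i.*2)%N => //=; exact: parE.
      by apply/side_support_eq0; [exact/om/parE|right].
    + split; first by exists (b + i.+1.*2)%N => //=; exact: parE.
      by apply/side_support_eq0; [exact/om/parE|left; rewrite doubleS !addnS].
  rewrite -hhull2 -E; apply: hhull_hface => [|_ [l /= ol <-]].
    apply: (@spacelike_of_orth _ (V (b + i.*2)) (V (b + i.*2 + 4))).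
      by apply/side_support_eq0; [exact/om/parE|right].
    have o4 : odd (b + i.*2 + 4) != odd m.
      by apply: om; rewrite oddD parE addbF.
    apply/eqP => /(side_support_eq0 o4) [].
      by rewrite /m -(addn2 (b + i.*2)) => /modn_offset; lia.
    by rewrite -addnS /m -(addn1 (b + i.*2)) => /modn_offset; lia.
  exact/side_support/om.
- by move=> i j; rewrite /hdist !doubleS !addnS !mink_vertSS.
- move=> i j; apply: hangle_mink; rewrite !doubleS !addnS ?mink_vertSS//.
  by rewrite -(addn4 (b + i.*2)) -(addn4 (b + j.*2)) !mink_vertD.
Qed.

Lemma base_image (b : bool) : mrot phi @` (V @` parity b) = V @` parity (~~ b).
Proof.
apply/seteqP; split => [_ [_ [i /= oi <-] <-]|_ [i /= oi <-]].
  by rewrite mrot_vert; exists i.+1 => //=; rewrite oi.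
exists (V (i + n.*2.-1)).
  exists (i + n.*2.-1)%N => //=; have := oddS n.*2.-1; rewrite prednK; last by lia.
  by rewrite odd_double oddD oi => /esym/negbFE ->; rewrite addbT negbK.
by rewrite mrot_vert -addnS prednK ?vert_periodic//; lia.
Qed.

Lemma lateral_hcongruent i j : hcongruent (lateral_face V i) (lateral_face V j).
Proof.
(* a nonnegative number congruent to j - i modulo 2n *)
pose k := (j + (i * n.*2 - i))%N.
have kE l : V (i + l + k) = V (j + l).
  apply/vert_eq; rewrite (_ : i + l + k = i * n.*2 + (j + l))%N ?modnMDl//.
  by rewrite /k; nia.
exists (iter k (mrot phi)); first exact/hisometry_iter/mrot_hisometry.
rewrite hhull_isometry; last exact/hisometry_iter/mrot_hisometry.
rewrite /lateral_face !image_setU !image_set1 !iter_mrot_vert.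
have := kE 0; have := kE 1; have := kE 2.
by rewrite !addn0 !addn1 !addn2 => -> -> ->.
Qed.

Lemma antiprism_hull : antiprism n P V.
Proof.
have topE : top_face V = hhull (V @` parity true) by [].
have botE : bottom_face V = hhull (V @` parity false).
  by congr (hhull (V @` _)); apply/seteqP; split => i /=; case: (odd i).
split.
- exact: hpolyhedron_hull.
- exact: cyclic_enum_verts.
- move=> F; rewrite topE botE; split; first exact: hfacet_cases.
  by case=> [->|->|[i ->]]; [exact: base_hfacet..|exact: lateral_hfacet].
- split; rewrite ?topE ?botE.
  + exact: (base_regular_polygon true).
  + exact: (base_regular_polygon false).
  + exists (mrot phi); first exact: mrot_hisometry.
    by rewrite hhull_isometry ?base_image//; exact: mrot_hisometry.
- exact: lateral_hcongruent.
Qed.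

Lemma S2n_symmetric_hull : S2n_symmetric n P V.
Proof.
exists (mrot phi); split; [exact: hmirror_rotation_mrot| |exact: mrot_vert].
rewrite hhull_isometry; last exact: mrot_hisometry.
congr hhull; apply/seteqP; split => [_ [_ [i _ <-] <-]|_ [i _ <-]].
  by exists i.+1; rewrite ?mrot_vert.
exists (V (i + n.*2.-1)); first by exists (i + n.*2.-1)%N.
by rewrite mrot_vert -addnS prednK ?vert_periodic//; lia.
Qed.

Lemma edge_lengths_vert (a c : R) : 0 <= a -> 0 <= c ->
  cosh a = 1 + 2 * r ^+ 2 * (1 - cos phi ^+ 2) ->
  cosh c = 1 + r ^+ 2 * (1 - cos phi) + 2 * h ^+ 2 ->
  edge_lengths V a c.
Proof.
move=> a0 c0 ha hc i; rewrite /hdist mink_vertS mink_vertSS !opprK.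
by rewrite -ha -hc !coshK.
Qed.

End Configuration.

(** * Necessity *)

Section Necessity.
Variable R : realType.
Implicit Types (u v w : 'rV[R]_4) (x : H3 R).

Lemma mink_mulmx m (A : 'M[R]_(m, 4)) u i :
  (A *m diag_mx (vec4 (-1) 1 1 1) *m u^T) i 0 = mink (row i A) u.
Proof.
rewrite mul_mx_diag !mxE !big_ord_recl big_ord0 /mink !big_ord_recl big_ord0 !mxE /=.
ring.
Qed.

(** Together with the component [w] of [x] orthogonal to [e1], [e2], [e3],
    these vectors have the invertible Gram matrix [diag(w.w, 1, 1, 1)]. *)
Lemma orthonormal_complete e1 e2 e3 x u : spacelike_orthonormal e1 e2 e3 ->
  mink u e1 = 0 -> mink u e2 = 0 -> mink u e3 = 0 -> mink u x = 0 -> u = 0.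
Proof.
move=> [[n1 n2 n3] [ o12 o13 o23]] u1 u2 u3 ux.
have [w wE] : exists w, w = hvec x - mink x e1 *: e1 - mink x e2 *: e2 - mink x e3 *: e3.
  by eexists.
have w1 : mink w e1 = 0 by rewrite wE !minkE n1 (minkC e2) (minkC e3) o12 o13; ring.
have w2 : mink w e2 = 0 by rewrite wE !minkE n2 (minkC e3) o12 o23; ring.
have w3 : mink w e3 = 0 by rewrite wE !minkE n3 o13 o23; ring.
have uw : mink u w = 0 by rewrite wE !minkE u1 u2 u3 ux; ring.
have ww : mink w w = -1 - mink x e1 ^+ 2 - mink x e2 ^+ 2 - mink x e3 ^+ 2.
  by rewrite {2}wE !minkE w1 w2 w3 minkC wE !minkE H3_norm; ring.
have wn : mink w w != 0.
  rewrite lt_eqF// ww; have := sqr_ge0 (mink x e1).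
  by have := sqr_ge0 (mink x e2); have := sqr_ge0 (mink x e3); lra.
pose E : 'M[R]_4 := \matrix_(i < 4) [:: w; e1; e2; e3]`_i.
pose J : 'M[R]_4 := diag_mx (vec4 (-1) 1 1 1).
have gram : E *m J *m E^T = diag_mx (vec4 (mink w w) 1 1 1).
  apply/matrixP => i j.
  transitivity (mink (row i E) (row j E)).
    by rewrite -mink_mulmx tr_row [RHS]mxE [LHS]mxE; apply: eq_bigr => k _; rewrite !mxE.
  rewrite !rowK !mxE.
  by case: i => [[|[|[|[|//]]]]] ?; case: j => [[|[|[|[|//]]]]] ? /=;
    rewrite ?mulr1n ?mulr0n //= minkC.
have Eu : E \in unitmx.
  rewrite unitmxE unitfE; apply: contraNneq wn => dE.
  have := congr1 determinant gram; rewrite !det_mulmx dE !mul0r det_diag.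
  by rewrite !big_ord_recl big_ord0 !mxE /= !mulr1 => /esym/eqP.
have Ju : J \in unitmx.
  by rewrite unitmxE unitfE det_diag !big_ord_recl big_ord0 !mxE /= !mulr1 oppr_eq0 oner_eq0.
have EJu : E *m J *m u^T = 0.
  apply/matrixP => i j; rewrite [j]ord1 mink_mulmx rowK mxE.
  by case: i => [[|[|[|[|//]]]]] ? /=; rewrite minkC.
have : u^T = 0 by rewrite -(mulKmx Ju u^T) -(mulKmx Eu (J *m u^T)) (mulmxA E) EJu !mulmx0.
by move=> /(congr1 trmx); rewrite trmxK trmx0.
Qed.

Section MirrorRotationCoordinates.
Variables (e1 e2 e3 : 'rV[R]_4) (phi : R).
Hypothesis on : spacelike_orthonormal e1 e2 e3.

Lemma hrefl_hrotE w : hrefl e3 (hrot e1 e2 phi w) =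
  w + (cos phi * mink w e1 - sin phi * mink w e2 - mink w e1) *: e1
    + (sin phi * mink w e1 + cos phi * mink w e2 - mink w e2) *: e2
    - (2 * mink w e3) *: e3.
Proof.
case: on => _ [_ o13 o23]; rewrite /hrefl /hrot !minkE o13 o23.
by congr (_ - (2 * _) *: _); ring.
Qed.

Lemma mink_mirror_e1 w : mink (hrefl e3 (hrot e1 e2 phi w)) e1 =
  cos phi * mink w e1 - sin phi * mink w e2.
Proof.
case: on => [[n1 _ _] [ o12 o13 _]].
by rewrite hrefl_hrotE !minkE n1 (minkC e2) (minkC e3) o12 o13; ring.
Qed.

Lemma mink_mirror_e2 w : mink (hrefl e3 (hrot e1 e2 phi w)) e2 =
  sin phi * mink w e1 + cos phi * mink w e2.
Proof.
case: on => [[_ n2 _] [ o12 _ o23]].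
by rewrite hrefl_hrotE !minkE n2 (minkC e3) o12 o23; ring.
Qed.

Lemma mink_mirror_e3 w : mink (hrefl e3 (hrot e1 e2 phi w)) e3 = - mink w e3.
Proof.
case: on => [[_ _ n3] [_ o13 o23]].
by rewrite hrefl_hrotE !minkE n3 o13 o23; ring.
Qed.

Variables (x y z : H3 R).
Hypothesis yE : hvec y = hrefl e3 (hrot e1 e2 phi x).
Hypothesis zE : hvec z = hrefl e3 (hrot e1 e2 phi y).

Lemma mink_mirror1 : mink x y =
  - (1 + (1 - cos phi) * (mink x e1 ^+ 2 + mink x e2 ^+ 2) + 2 * mink x e3 ^+ 2).
Proof. by rewrite yE hrefl_hrotE !minkE H3_norm; ring. Qed.

Lemma mink_mirror2 : mink x z =
  - (1 + 2 * (1 - cos phi ^+ 2) * (mink x e1 ^+ 2 + mink x e2 ^+ 2)).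
Proof.
rewrite zE hrefl_hrotE !minkE mink_mirror1.
rewrite yE mink_mirror_e1 mink_mirror_e2 mink_mirror_e3.
transitivity (- 1 + (cos phi ^+ 2 - sin phi ^+ 2 - 1)
  * (mink x e1 ^+ 2 + mink x e2 ^+ 2)); first by ring.
have -> : sin phi ^+ 2 = 1 - cos phi ^+ 2 by have := cos2Dsin2 phi; lra.
by ring.
Qed.

(** When [x] is in the plane of symmetry, [y - x] and [z - y] are combinations
    of [e1] and [e2], the second being the first rotated by [phi]; so they span
    the same plane, and [v] is orthogonal to [e1], [e2] and [x]. *)
Lemma normal_of_planar_triangle v : sin phi != 0 -> cos phi != 1 ->
  mink x e1 ^+ 2 + mink x e2 ^+ 2 != 0 -> mink x e3 = 0 ->
  mink x v = 0 -> mink y v = 0 -> mink z v = 0 -> v = mink v e3 *: e3.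
Proof.
move=> sn cn rn x3 xv yv zv.
have y3 : mink y e3 = 0 by rewrite yE mink_mirror_e3 x3 oppr0.
set x1 := mink x e1 in rn *; set x2 := mink x e2 in rn *.
set C := cos phi in cn *; set S := sin phi in sn *.
have y1 : mink y e1 = C * x1 - S * x2 by rewrite yE mink_mirror_e1.
have y2 : mink y e2 = S * x1 + C * x2 by rewrite yE mink_mirror_e2.
have ey : (C * x1 - S * x2 - x1) * mink e1 v + (S * x1 + C * x2 - x2) * mink e2 v = 0.
  by rewrite -[RHS]yv yE hrefl_hrotE x3 !minkE xv -/x1 -/x2 -/C -/S; ring.
have ez : (C * (C * x1 - S * x2) - S * (S * x1 + C * x2) - (C * x1 - S * x2)) * mink e1 v
   + (S * (C * x1 - S * x2) + C * (S * x1 + C * x2) - (S * x1 + C * x2)) * mink e2 v = 0.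
  by rewrite -[RHS]zv zE hrefl_hrotE y3 !minkE yv y1 y2 -/C -/S; ring.
pose d1 := C * x1 - S * x2 - x1; pose d2 := S * x1 + C * x2 - x2.
have CS : C ^+ 2 + S ^+ 2 = 1 by exact: cos2Dsin2.
have dn : d1 ^+ 2 + d2 ^+ 2 != 0.
  have -> : d1 ^+ 2 + d2 ^+ 2 = 2 * (1 - C) * (x1 ^+ 2 + x2 ^+ 2).
    transitivity ((C ^+ 2 + S ^+ 2 + 1 - 2 * C) * (x1 ^+ 2 + x2 ^+ 2)).
      by rewrite /d1 /d2; ring.
    by rewrite CS; ring.
  by rewrite !mulf_neq0// ?pnatr_eq0// subr_eq0 eq_sym.
have e12 : d1 * mink e2 v = d2 * mink e1 v.
  apply: (mulfI sn); apply/eqP; rewrite -subr_eq0; apply/eqP.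
  transitivity (((C * d1 - S * d2) * mink e1 v + (S * d1 + C * d2) * mink e2 v)
    - C * (d1 * mink e1 v + d2 * mink e2 v)); first by ring.
  rewrite [d1 * mink e1 v + _]ey mulr0 subr0 -[RHS]ez /d1 /d2; ring.
have p0 : mink e1 v = 0.
  apply: (mulfI dn); rewrite mulr0 mulrDl.
  transitivity (d1 * (d1 * mink e1 v) + d2 * (d2 * mink e1 v)); first by ring.
  rewrite -e12; transitivity (d1 * (d1 * mink e1 v + d2 * mink e2 v)); first by ring.
  by rewrite [d1 * mink e1 v + _]ey mulr0.
have q0 : mink e2 v = 0.
  apply: (mulfI dn); rewrite mulr0 mulrDl.
  transitivity (d1 * (d1 * mink e2 v) + d2 * (d2 * mink e2 v)); first by ring.
  rewrite e12 p0; transitivity (d2 * (d1 * mink e1 v + d2 * mink e2 v)); last first.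
    by rewrite [d1 * mink e1 v + _]ey mulr0.
  by rewrite p0; ring.
case: (on) => [[n1 n2 n3] [ o12 o13 o23]].
apply/eqP; rewrite -subr_eq0; apply/eqP; apply: (orthonormal_complete (x := x) on).
- by rewrite !minkE (minkC v e1) p0 (minkC e3 e1) o13; ring.
- by rewrite !minkE (minkC v e2) q0 (minkC e3 e2) o23; ring.
- by rewrite !minkE n3; ring.
- by rewrite !minkE (minkC v x) xv (minkC e3 x) x3; ring.
Qed.

End MirrorRotationCoordinates.

(** The heart of the criterion: with [rho] and [eta] the squared hyperbolic
    sines of the distances from the vertices to the axis and to the plane of
    symmetry, the edge lengths are given by the two hypotheses, and [rho]
    cancels out of the quantity of the theorem. *)
Lemma condition_height (C A B rho eta : R) :
  A = 1 + 2 * rho * (1 - C ^+ 2) -> B = 1 + rho * (1 - C) + 2 * eta ->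
  1 + A - 2 * B + 2 * (1 - B) * C = - (4 * (1 + C) * eta).
Proof. by move=> -> ->; ring. Qed.

(** If the vertices were in the plane of symmetry, this plane would carry a
    lateral face.  A facet has the polyhedron on one side, and the mirror
    rotation exchanges the sides, so the polyhedron would be planar. *)
Lemma antiprism_condition n (P : set (H3 R)) (V : nat -> H3 R) a c : (3 <= n)%N ->
  0 < a -> antiprism n P V -> S2n_symmetric n P V -> edge_lengths V a c ->
  1 + cosh a - 2 * cosh c + 2 * (1 - cosh c) * cos (pi / n%:R) < 0.
Proof.
move=> n3 a0 [[_ nondeg] _ facets _ _] [g [[e1 [e2 [e3 [on gE]]]] gP gV]] len.
have n1 : (1 < n)%N by lia.
have V1 : hvec (V 1) = hrefl e3 (hrot e1 e2 (step R n) (V 0)) by rewrite -gV gE.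
have V2 : hvec (V 2) = hrefl e3 (hrot e1 e2 (step R n) (V 1)) by rewrite -gV gE.
have [la lc] := len 0%N.
have := cosh_hdist (V 0) (V 2); have := cosh_hdist (V 0) (V 1).
rewrite la lc (mink_mirror1 on V1) (mink_mirror2 on V1 V2) !opprK -/(step R n).
set x1 := mink _ e1; set x2 := mink _ e2; set x3 := mink _ e3 => hc ha.
have C1 := cos_step_lt1 R n1; have CN1 := cos_step_gtN1 R n1.
have rho0 : x1 ^+ 2 + x2 ^+ 2 != 0.
  apply/eqP => r0; have := cosh_gt1 a0.
  by rewrite ha r0 mulr0 addr0 ltxx.
rewrite (@condition_height _ _ _ (x1 ^+ 2 + x2 ^+ 2) (x3 ^+ 2)); first last.
- by rewrite hc; ring.
- by rewrite ha; ring.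
rewrite oppr_lt0 pmulr_rgt0; last by lra.
rewrite lt_def sqr_ge0 andbT sqrf_eq0; apply/negP => /eqP x30.
have [[v [v0 leP faceE]] _] : hfacet P (lateral_face V 0).
  by apply/facets/Or33; exists 0%N.
have vV (x : H3 R) : [set V 0; V 1; V 2] x -> mink x v = 0.
  by move=> Vx; have := @sub_hhull _ [set V 0; V 1; V 2] _ Vx;
    rewrite -/(lateral_face V 0) faceE => -[].
have vE := normal_of_planar_triangle on V1 V2 (lt0r_neq0 (sin_step_gt0 R n1))
  (negbT (lt_eqF C1)) rho0 x30 (vV _ (or_introl (or_introl erefl)))
  (vV _ (or_introl (or_intror erefl))) (vV _ (or_intror erefl)).
(* g preserves P and changes the sign of mink _ v *)
apply: (nondeg v v0) => z Pz; apply/eqP; rewrite eq_le leP//= -oppr_le0.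
have : P (g z) by rewrite -gP; exists z.
move=> /leP; rewrite vE !minkZr gE mink_mirror_e3// mulrN.
by rewrite -minkZr -vE.
Qed.

End Necessity.

(** * The existence criterion *)

Theorem theorem3p1 (R : realType) (n : nat) (a c : R)
    (hn : (3 <= n)%N) (ha : 0 < a) (hc : 0 < c) :
  (exists (P : set (H3 R)) (V : nat -> H3 R),
     [/\ antiprism n P V, S2n_symmetric n P V & edge_lengths V a c]) <->
  1 + cosh a - 2 * cosh c + 2 * (1 - cosh c) * cos (pi / n%:R) < 0.
Proof.
split=> [[P [V [antiP symP len]]]|].
  exact: (antiprism_condition hn ha antiP symP len).
have n1 : (1 < n)%N by lia.
have C1 := cos_step_lt1 R n1; have CN1 := cos_step_gtN1 R n1.
rewrite -/(step R n); set C := cos (step R n) in C1 CN1 * => cond.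
pose rho := (cosh a - 1) / (2 * (1 - C ^+ 2)).
have C2 : 0 < 1 - C ^+ 2 by nra.
have rho0 : 0 < rho by rewrite divr_gt0// ?subr_gt0 ?cosh_gt1//; lra.
have aE : cosh a = 1 + 2 * rho * (1 - C ^+ 2).
  by rewrite /rho; field; rewrite lt0r_neq0.
pose eta := (cosh c - 1 - rho * (1 - C)) / 2.
have cE : cosh c = 1 + rho * (1 - C) + 2 * eta by rewrite /eta; field.
have eta0 : 0 < eta.
  move: cond; rewrite (condition_height aE cE) oppr_lt0 pmulr_rgt0//; lra.
pose r := Num.sqrt rho; pose h := Num.sqrt eta.
have r0 : 0 < r by rewrite sqrtr_gt0.
have h0 : h != 0 by rewrite lt0r_neq0// sqrtr_gt0.
exists (hhull (range (vert n r h))), (vert n r h); split.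
- exact: antiprism_hull.
- exact: S2n_symmetric_hull.
- by apply: edge_lengths_vert; rewrite ?(ltW ha) ?(ltW hc)// !sqr_sqrtr// ltW.
Qed.
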